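(* Let $a_0\in H^1(I)$ be the unique solution of Problem (P), and assume $a_0(g_1)=0$. For $0<\alpha<1$ let $a_\alpha$ be the regularized solution defined in the context. Then: (1) $\|a_0-a_\alpha\|_{H^1(I)}\to 0$ as $\alpha\to 0$. (2) $\|a_0-a_\alpha\|_{L^2(I)}\le \sqrt{\alpha}\,\|a_0'\|_{L^2(I)}$. (3) If $a_0\in H^3(I)$, then $\|a_0-a_\alpha\|_{H^1(I)}\le (1+C_L)\,\alpha\,\|a_0'\|_{H^2(I)}$.
   Context: Setting. $\Omega\subset\mathbb{R}^3$ is a bounded domain with $C^{1,1}$ boundary, $p>3$, $j\in W^{1-1/p,p}(\partial\Omega)$ with $\int_{\partial\Omega}j=0$. $\gamma:[0,1]\to\partial\Omega$ is a $C^1$ curve, $\Gamma=\gamma([0,1])$, and $g\in C^1(\Gamma)$ is real valued, with $C_\gamma\le|\gamma'(s)|\le C'_\gamma$ and $C_g\le|g'(\gamma(s))|\le C'_g$ for all $s\in[0,1]$ and some positive constants; $g'$ is the derivative of $g$ along $\Gamma$ (with respect to arc length), so $|(g\circ\gamma)'(s)|=|g'(\gamma(s))|\,|\gamma'(s)|$. Put $I=g(\Gamma)=[g_0,g_1]$, $g_0<g_1$. Norms are the standard ones: $\|w\|_{H^k(I)}^2=\sum_{i=0}^k\|w^{(i)}\|_{L^2(I)}^2$. Problem (P): identify, on $I$, a function $a\in H^1(\mathbb{R})$ such that the solution $u$ of $-\nabla\cdot(a(u)\nabla u)=0$ in $\Omega$, $a(u)\,\partial u/\partial\nu=j$ on $\partial\Omega$,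 satisfies $u=g$ on $\Gamma$. It is known (and may be taken as the definition) that $a_0\in H^1(I)$ is the solution of Problem (P) if and only if $$\int_{g_0}^{g(\gamma(s))}a_0(t)\,dt=v^j(\gamma(s)),\qquad s\in[0,1],$$ where $v^j\in C^1(\overline\Omega)$ is the unique function with $-\Delta v^j=0$ in $\Omega$, $\partial v^j/\partial\nu=j$ on $\partial\Omega$, $\int_\Omega v^j=0$. Regularized solution. Let $\mathcal{W}=\{w\in H^2(I): w(g_0)=0,\ w'(g_1)=0\}$ (with the $H^2(I)$ inner product) and, for $\alpha>0$, let $T_2^\alpha:\mathcal{W}\to L^2(I)$, $T_2^\alpha w=w-\alpha w''$. Let $\zeta_0\in L^2(I)$ be the function with $\zeta_0(g(\gamma(s)))=v^j(\gamma(s))$, $s\in[0,1]$; let $b_\alpha\in\mathcal{W}$ be the unique solution of $(T_2^\alpha)^*T_2^\alpha b_\alpha=(T_2^\alpha)^*\zeta_0$; and set $a_\alpha=b_\alpha'$. Constant $C_L$. $C_L=\|\mathrm{id}-L\|$ is the operator norm on $H^2(I)$, where (for the given $\alpha$) $L:H^2(I)\to H^2(I)$ is $$Lx(t)=x'(g_1)\sqrt{\alpha}\,\frac{e^{(t-g_0)/\sqrt\alpha}-e^{-(t-g_0)/\sqrt\alpha}}{e^{(g_1-g_0)/\sqrt\alpha}+e^{-(g_1-g_0)/\sqrt\alpha}}+x(g_0)\,\frac{e^{(t-g_1)/\sqrt\alpha}+e^{-(t-g_1)/\sqrt\alpha}}{e^{(g_0-g_1)/\sqrt\alpha}+e^{-(g_0-g_1)/\sqrt\alpha}}.$$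 *)

(* Defs.v *)
From HB Require Import structures.
From mathcomp Require Import all_boot all_order all_algebra.
From mathcomp Require Import all_classical all_reals all_analysis.

Set Implicit Arguments.
Unset Strict Implicit.
Unset Printing Implicit Defensive.

Import Order.TTheory GRing.Theory Num.Theory numFieldNormedType.Exports.
Local Open Scope classical_set_scope.
Local Open Scope ring_scope.

(* R^3 is the product type R * R * R, whose topology, Borel sets and Lebesgue
   measure come from the library.  Its library norm is the sup norm, so the
   Euclidean structure is given explicitly. *)

Section Euclidean.
Context {R : realType}.
Implicit Types x y : R * R * R.

Definition dot3 x y : R := x.1.1 * y.1.1 + x.1.2 * y.1.2 + x.2 * y.2.

Definition enorm3 x : R := Num.sqrt (dot3 x x).

Definition leb2 := ((@lebesgue_measure R) \x (@lebesgue_measure R))%E.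

Definition leb3 := (leb2 \x (@lebesgue_measure R))%E.

End Euclidean.

Section Domains.
Context {R : realType}.
Implicit Types (Omega : set (R * R * R)) (x : R * R * R) (y z : R * R).

Definition boundary Omega : set (R * R * R) := closure Omega `\` interior Omega.

Definition bounded_domain Omega : Prop :=
  [/\ open Omega, connected Omega, Omega !=set0 & bounded_set Omega].

(* Data of a local graph representation of a boundary: an open ball, a frame
   (e1, e2, e3), and a function phi with gradient dphi. *)
Record graph_chart := GraphChart {
  gc_center : R * R * R;
  gc_radius : R;
  gc_e1 : R * R * R;
  gc_e2 : R * R * R;
  gc_e3 : R * R * R;
  gc_phi : R * R -> R;
  gc_dphi : R * R -> R * R }.

Implicit Types c : graph_chart.

Definition gc_ball c : set (R * R * R) :=
  [set x | enorm3 (x - gc_center c) < gc_radius c].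

Definition gc_param c y : R * R * R :=
  y.1 *: gc_e1 c + y.2 *: gc_e2 c + gc_phi c y *: gc_e3 c.

Definition orthonormal_frame c : Prop :=
  [/\ dot3 (gc_e1 c) (gc_e1 c) = 1, dot3 (gc_e2 c) (gc_e2 c) = 1 &
      dot3 (gc_e3 c) (gc_e3 c) = 1] /\
  [/\ dot3 (gc_e1 c) (gc_e2 c) = 0, dot3 (gc_e1 c) (gc_e3 c) = 0 &
      dot3 (gc_e2 c) (gc_e3 c) = 0].

Definition gc_C11 c : Prop :=
  (forall y, differentiable (gc_phi c) y /\
     forall h, 'd (gc_phi c) y h = (gc_dphi c y).1 * h.1 + (gc_dphi c y).2 * h.2)
  /\ exists K : R, forall y z, `|gc_dphi c y - gc_dphi c z| <= K * `|y - z|.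

(* Inside the ball, Omega is the part lying strictly above the graph of phi in
   the coordinates of the frame. *)
Definition C11_chart Omega c : Prop :=
  [/\ 0 < gc_radius c, orthonormal_frame c, gc_C11 c &
      forall x, gc_ball c x ->
        (Omega x <->
         gc_phi c (dot3 x (gc_e1 c), dot3 x (gc_e2 c)) < dot3 x (gc_e3 c))].

Definition C11_boundary Omega : Prop :=
  forall x, boundary Omega x -> exists2 c, C11_chart Omega c & gc_center c = x.

Definition area_density c y : R :=
  Num.sqrt (1 + (gc_dphi c y).1 ^+ 2 + (gc_dphi c y).2 ^+ 2).

(* Omega lies above the graph, so the outward unit normal points down. *)
Definition outward_normal c x : R * R * R :=
  let y := (dot3 x (gc_e1 c), dot3 x (gc_e2 c)) in
  (area_density c y)^-1 *:
    ((gc_dphi c y).1 *: gc_e1 c + (gc_dphi c y).2 *: gc_e2 c - gc_e3 c).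

(* The surface measure of the boundary, as the Borel measure on R^3 carried by
   the boundary and given in every chart by the area formula for graphs; since
   charts cover the boundary, these conditions determine it. *)
Definition is_surface_measure Omega
    (sigma : {measure set (R * R * R) -> \bar R}) : Prop :=
  sigma (~` boundary Omega) = 0%E /\
  forall c, C11_chart Omega c ->
  forall A : set (R * R * R), measurable A -> A `<=` boundary Omega `&` gc_ball c ->
    sigma A =
    (\int[leb2]_(y in [set y | A (gc_param c y)]) (area_density c y)%:E)%E.

(* W^{1-1/p,p} of the boundary with the Gagliardo (Slobodeckij) seminorm; the
   boundary has dimension 2 and 2 + (1 - 1/p) p = p + 1. *)
Definition trace_space Omega (sigma : {measure set (R * R * R) -> \bar R})
    (p : R) (f : R * R * R -> R) : Prop :=
  [/\ measurable_fun (boundary Omega) f,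
      (\int[sigma]_(x in boundary Omega) (`|f x| `^ p)%:E < +oo)%E &
      (\int[sigma]_(x in boundary Omega) \int[sigma]_(y in boundary Omega)
         (`|f x - f y| `^ p / enorm3 (x - y) `^ (p + 1))%:E < +oo)%E].

(* v is C^1 up to the boundary, with gradient dv. *)
Definition C1_closure Omega (v : R * R * R -> R) (dv : R * R * R -> R * R * R) : Prop :=
  [/\ {within closure Omega, continuous v},
      {within closure Omega, continuous dv} &
      forall x, Omega x -> differentiable v x /\
        forall h, 'd v x h = dot3 (dv x) h].

Definition C2_on Omega (v : R * R * R -> R) : Prop :=
  forall (h k : R * R * R) x, Omega x ->
    derivable ('D_h v) x k /\ {for x, continuous ('D_k ('D_h v))}.

Definition laplacian (v : R * R * R -> R) x : R :=
  'D_(1, 0, 0) ('D_(1, 0, 0) v) x + 'D_(0, 1, 0) ('D_(0, 1, 0) v) x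
  + 'D_(0, 0, 1) ('D_(0, 0, 1) v) x.

Definition neumann_solution Omega (sigma : {measure set (R * R * R) -> \bar R})
    (j v : R * R * R -> R) : Prop :=
  exists dv : R * R * R -> R * R * R,
  [/\ C1_closure Omega v dv,
      C2_on Omega v /\ (forall x, Omega x -> - laplacian v x = 0),
      {ae sigma, forall x, boundary Omega x ->
         forall c, C11_chart Omega c -> gc_ball c x ->
           dot3 (dv x) (outward_normal c x) = j x} &
      \int[leb3]_(x in Omega) v x = 0].

(* gamma is C^1 on [0, 1] with derivative dgamma; the one-sided derivatives at
   the end points are the limits of dgamma. *)
Definition C1_curve (gamma dgamma : R -> R * R * R) : Prop :=
  [/\ {within `[0, 1]%classic, continuous gamma},
      {within `[0, 1]%classic, continuous dgamma} &
      forall s : R, s \in `]0, 1[ -> is_derive s 1 gamma (dgamma s)].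

(* g is C^1 on the image of gamma, dg being its derivative with respect to arc
   length in the direction of gamma. *)
Definition C1_along (gamma dgamma : R -> R * R * R) (g dg : R * R * R -> R) : Prop :=
  [/\ {within gamma @` `[0, 1]%classic, continuous g},
      {within gamma @` `[0, 1]%classic, continuous dg} &
      forall s : R, s \in `]0, 1[ ->
        is_derive s 1 (g \o gamma) (dg (gamma s) * enorm3 (dgamma s))].

End Domains.

(* Functions on I = [g0, g1] are functions R -> R considered on I only. *)

Section Sobolev.
Context {R : realType}.
Variables g0 g1 : R.
Implicit Types f h w z phi : R -> R.

Let I : set R := `[g0, g1]%classic.

Definition L2 f : Prop :=
  measurable_fun I f /\
  (\int[lebesgue_measure]_(t in I) ((f t) ^+ 2)%:E < +oo)%E.

Definition L2_dot f h : R := \int[lebesgue_measure]_(t in I) (f t * h t).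

Definition L2_norm f : R := Num.sqrt (L2_dot f f).

(* Test functions are C^1 with compact support in ]g0, g1[ (as in Brezis); they
   give the same weak derivatives as smooth ones. *)
Definition test_function phi : Prop :=
  [/\ forall t, derivable phi t 1, continuous (derive1 phi) &
      exists c d, [/\ g0 < c, d < g1 & forall t, t \notin `[c, d] -> phi t = 0]].

Definition is_weak_derivative f h : Prop :=
  forall phi, test_function phi ->
    L2_dot f (derive1 phi) = - L2_dot h phi.

(* Elements of H^k, k >= 1, are identified with their continuous
   representatives, so that point values make sense. *)
Fixpoint sobolev (k : nat) f : Prop :=
  if k is k'.+1 then
    [/\ L2 f, {within I, continuous f} &
        exists2 h, is_weak_derivative f h & sobolev k' h]
  else L2 f.

(* The weak derivative in L^2, by choice: the continuous one if there is one. *)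
Definition wderiv f : R -> R :=
  let D := [set h | L2 h /\ is_weak_derivative f h] in
  xget (xget (fun=> 0) D) (D `&` [set h | {within I, continuous h}]).

Definition sobolev_dot (k : nat) f h : R :=
  \sum_(i < k.+1) L2_dot (iter i wderiv f) (iter i wderiv h).

Definition sobolev_norm (k : nat) f : R := Num.sqrt (sobolev_dot k f f).

Definition W2 w : Prop := [/\ sobolev 2 w, w g0 = 0 & wderiv w g1 = 0].

Definition T2 (alpha : R) w : R -> R :=
  fun t => w t - alpha * wderiv (wderiv w) t.

(* Ts is the Hilbert space adjoint of T : (V, dotV) -> (W, dotW). *)
Definition is_adjoint (V : (R -> R) -> Prop) (dotV : (R -> R) -> (R -> R) -> R)
    (W : (R -> R) -> Prop) (dotW : (R -> R) -> (R -> R) -> R)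
    (T Ts : (R -> R) -> R -> R) : Prop :=
  (forall z, W z -> V (Ts z)) /\
  (forall w z, V w -> W z -> dotW (T w) z = dotV w (Ts z)).

(* The adjoint exists, and is unique as an operator between functions on I. *)
Definition normal_equation (alpha : R) (zeta0 b : R -> R) : Prop :=
  exists2 Ts, is_adjoint W2 (sobolev_dot 2) L2 L2_dot (T2 alpha) Ts &
    {in `[g0, g1], Ts (T2 alpha b) =1 Ts zeta0}.

Definition solves_P (v : R * R * R -> R) (gamma : R -> R * R * R)
    (g : R * R * R -> R) (a0 : R -> R) : Prop :=
  sobolev 1 a0 /\
  forall s : R, s \in `[0, 1] ->
    \int[lebesgue_measure]_(t in `[g0, g (gamma s)]) a0 t = v (gamma s).

Definition Lop (alpha : R) (x : R -> R) : R -> R := fun t =>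
  let e u := expR (u / Num.sqrt alpha) in
  wderiv x g1 * Num.sqrt alpha
    * ((e (t - g0) - e (- (t - g0))) / (e (g1 - g0) + e (- (g1 - g0))))
  + x g0 * ((e (t - g1) + e (- (t - g1))) / (e (g0 - g1) + e (- (g0 - g1)))).

Definition C_L (alpha : R) : R :=
  sup [set sobolev_norm 2 (x \- Lop alpha x) |
        x in [set x | sobolev 2 x /\ sobolev_norm 2 x <= 1]].

End Sobolev.

(* Main.v *)
Require Import Defs.
From HB Require Import structures.
From mathcomp Require Import all_boot all_order all_algebra.
From mathcomp Require Import all_classical all_reals all_analysis.
From mathcomp Require Import measurable_realfun.
From mathcomp Require Import ring lra.

Set Implicit Arguments.
Unset Strict Implicit.
Unset Printing Implicit Defensive.

Import Order.TTheory GRing.Theory Num.Theory numFieldNormedType.Exports.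
Local Open Scope classical_set_scope.
Local Open Scope ring_scope.

(** The curve only serves to identify the data on the interval: as [g] maps it
   onto [g0, g1], the function [zeta0] is the integral of [a0] from [g0], so that
   [zeta0] belongs to [W2], its two boundary conditions being [zeta0 g0 = 0] and
   [a0 g1 = 0].

   The operator [T2 alpha] has dense range ([orthogonal_range_T2]), so the normal
   equation just says [b - alpha b'' = zeta0]. Hence [b2 = b'' = (b - zeta0) / alpha]
   is continuous. Put [e = a0 - b'] for the error and [f = a0'], so that
   [e' = f - b2]. Then [b2' = - e / alpha], while [e g1 = 0] and [b2 g0 = 0], and
   integrating [e' b2] by parts gives the energy identity
   [|e|^2 + alpha |e'|^2 = alpha <e', f>] ([error_energy]).

   It follows that [|e'| <= |f|], and then [|e| <= sqrt alpha |f|]. It also follows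
   that [|e'|^2 <= <e', f>]; here [e'] is bounded and [e] tends to 0 in L2, so [e']
   tends weakly to 0, and the inequality turns this into strong convergence.
   Concretely, [f] is replaced by a test function and [e'] is integrated by parts
   ([error_H1]).

   For the last estimate, [y = b2] solves [y - alpha y'' = f], and [e = - alpha y'].
   The function [f - L f] satisfies the boundary conditions of [y], and its H^2 norm
   is at most [C_L] times that of [f]; what remains of [y] is [alpha] times the
   solution of the same boundary value problem with right-hand side [f''], whose
   H^2 norm an energy estimate bounds by [|f''| / alpha] ([error_H1_order]). Since [C_L] is a supremum, the operator
   [id - L] has to be shown bounded, which is the trace inequality ([Lop_bounded]).

   All this is integration by parts for functions with a weak derivative in L2.
   It rests on the density of test functions in L2 ([test_function_dense]) and on
   the identification of H^1 functions with integrals of L2 functions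
   ([weak_derivative_primitive]). *)

(** * The space L2 of the interval *)

Section L2_space.
Context {R : realType} (g0 g1 : R).
Local Notation mu := (@lebesgue_measure R).
Local Notation I := (`[g0, g1]%classic : set R).
Local Notation L2 := (L2 g0 g1).
Local Notation dot := (L2_dot g0 g1).
Local Notation nrm := (L2_norm g0 g1).
Implicit Types f h k : R -> R.

Let mI : measurable I. Proof. exact: measurable_itv. Qed.

Let fin_muI : (mu I < +oo)%E.
Proof.
by rewrite lebesgue_measure_itv /=; case: ifP => // _; rewrite -EFinD ltry.
Qed.

Lemma L2_sqr_integrable f : L2 f -> mu.-integrable I (EFin \o (fun t => f t ^+ 2)).
Proof.
move=> [mf f2]; apply/integrableP; split.
  by apply/measurable_EFinP; exact: measurable_funX.
under eq_integral do rewrite /= ger0_norm ?sqr_ge0//.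
exact: f2.
Qed.

Lemma integrable_sqr_L2 f : measurable_fun I f ->
  mu.-integrable I (EFin \o (fun t => f t ^+ 2)) -> L2 f.
Proof.
move=> mf /integrableP[_ fi]; split => //; apply: le_lt_trans fi.
apply: ge0_le_integral => //.
- by move=> x _; rewrite lee_fin sqr_ge0.
- by apply/measurable_EFinP; exact: measurable_funX.
- by apply/measurable_EFinP/measurableT_comp => //; exact: measurable_funX.
- by move=> x _; rewrite lee_fin ler_norm.
Qed.

Lemma L2_dot_integrable f h : L2 f -> L2 h ->
  mu.-integrable I (EFin \o (fun t => f t * h t)).
Proof.
move=> Lf Lh.
apply: (@le_integrable _ _ _ mu I mI _ (EFin \o (fun t => f t ^+ 2 + h t ^+ 2))).
- by apply/measurable_EFinP/measurable_funM; [exact: (proj1 Lf)|exact: (proj1 Lh)].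
- move=> t _ /=; rewrite lee_fin [leRHS]ger0_norm ?addr_ge0 ?sqr_ge0// ler_norml.
  have := sqr_ge0 (f t + h t); have := sqr_ge0 (f t - h t).
  have := sqr_ge0 (f t); have := sqr_ge0 (h t).
  by move=> *; apply/andP; split; nra.
- exact: (@integrableD _ _ _ mu I mI (EFin \o (fun t => f t ^+ 2))
    (EFin \o (fun t => h t ^+ 2)) (L2_sqr_integrable Lf) (L2_sqr_integrable Lh)).
Qed.

Lemma eq_L2 f h : {in I, f =1 h} -> L2 f -> L2 h.
Proof.
move=> fh [mf f2]; split; first exact: eq_measurable_fun mf.
by under eq_integral => t tI do rewrite -fh//.
Qed.

Lemma bounded_L2 f (M : R) : measurable_fun I f ->
  (forall t, I t -> `|f t| <= M) -> L2 f.
Proof.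
move=> mf fM; apply: integrable_sqr_L2 => //.
apply: measurable_bounded_integrable => //; first exact: measurable_funX.
exists (M ^+ 2); split; rewrite ?num_real// => x Mx t /= It.
rewrite normrX (le_trans _ (ltW Mx))// ler_pXn2r ?nnegrE ?fM//.
exact: le_trans (fM _ It).
Qed.

Lemma continuous_L2 f : {within I, continuous f} -> L2 f.
Proof.
move=> cf.
have [M [_ fM]] : bounded_set (f @` I).
  exact/compact_bounded/continuous_compact/segment_compact.
apply: (@bounded_L2 _ (M + 1)).
  by apply: subspace_continuous_measurable_fun.
by move=> t It; apply: fM; [rewrite ltrDl|exists t].
Qed.

Lemma L2_cst (c : R) : L2 (cst c).
Proof. by apply: (@bounded_L2 _ `|c|) => //. Qed.

Lemma L2Z (c : R) f : L2 f -> L2 (c \*o f).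
Proof.
move=> Lf; have [mf _] := Lf; apply: integrable_sqr_L2.
  exact: measurable_funM.
pose F : R -> \bar R := EFin \o (fun t => f t ^+ 2).
have -> : EFin \o (fun t => (c \*o f) t ^+ 2) = (fun t => (c ^+ 2)%:E * F t)%E.
  by apply/funext => t /=; rewrite exprMn.
exact/integrableZl/L2_sqr_integrable.
Qed.

Lemma L2D f h : L2 f -> L2 h -> L2 (f \+ h).
Proof.
move=> Lf Lh; apply: integrable_sqr_L2.
  by apply: measurable_funD; [exact: (proj1 Lf)|exact: (proj1 Lh)].
pose F : R -> \bar R := EFin \o (fun t => f t ^+ 2).
pose H : R -> \bar R := EFin \o (fun t => h t ^+ 2).
pose K : R -> \bar R := EFin \o (fun t => f t * h t).
have -> : EFin \o (fun t => (f \+ h) t ^+ 2) =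
    (F \+ (H \+ (fun t => 2%:E * K t)))%E.
  by apply/funext => t /=; rewrite -EFinM -!EFinD; congr (_%:E); ring.
apply/integrableD/integrableD/integrableZl/L2_dot_integrable => //.
- exact: L2_sqr_integrable.
- exact: L2_sqr_integrable.
Qed.

Lemma L2B f h : L2 f -> L2 h -> L2 (f \- h).
Proof.
move=> Lf Lh; have -> : f \- h = f \+ (-1 \*o h).
  by apply/funext => t /=; rewrite mulN1r.
exact/L2D/L2Z.
Qed.

Lemma eq_dot f h f' h' : {in I, f =1 f'} -> {in I, h =1 h'} ->
  dot f h = dot f' h'.
Proof. by move=> ff hh; apply: eq_Rintegral => t tI; rewrite ff// hh. Qed.

Lemma dotC f h : dot f h = dot h f.
Proof. by apply: eq_Rintegral => t _; rewrite mulrC. Qed.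

Lemma dotZl (c : R) f h : L2 f -> L2 h -> dot (c \*o f) h = c * dot f h.
Proof.
move=> Lf Lh; rewrite -RintegralZl//; last exact: L2_dot_integrable.
by apply: eq_Rintegral => t _ /=; rewrite mulrA.
Qed.

Lemma dotZr (c : R) f h : L2 f -> L2 h -> dot f (c \*o h) = c * dot f h.
Proof. by move=> Lf Lh; rewrite dotC dotZl// dotC. Qed.

Lemma dotDl f h k : L2 f -> L2 h -> L2 k -> dot (f \+ h) k = dot f k + dot h k.
Proof.
move=> Lf Lh Lk; rewrite -RintegralD//; [|exact: L2_dot_integrable..].
by apply: eq_Rintegral => t _ /=; rewrite mulrDl.
Qed.

Lemma dotDr f h k : L2 f -> L2 h -> L2 k -> dot k (f \+ h) = dot k f + dot k h.
Proof. by move=> *; rewrite dotC dotDl// ![dot _ k]dotC. Qed.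

Lemma dotBl f h k : L2 f -> L2 h -> L2 k -> dot (f \- h) k = dot f k - dot h k.
Proof.
move=> Lf Lh Lk; rewrite -RintegralB//; [|exact: L2_dot_integrable..].
by apply: eq_Rintegral => t _ /=; rewrite mulrBl.
Qed.

Lemma dotBr f h k : L2 f -> L2 h -> L2 k -> dot k (f \- h) = dot k f - dot k h.
Proof. by move=> *; rewrite dotC dotBl// ![dot _ k]dotC. Qed.

Lemma dot_ge0 f : 0 <= dot f f.
Proof. by apply: Rintegral_ge0 => t _; rewrite -expr2 sqr_ge0. Qed.

Lemma nrm_ge0 f : 0 <= nrm f. Proof. exact: sqrtr_ge0. Qed.

Lemma sqr_nrm f : nrm f ^+ 2 = dot f f.
Proof. by rewrite sqr_sqrtr// dot_ge0. Qed.

(** The step from a nonnegative quadratic form to the Cauchy-Schwarz inequality,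
   made once for the scalar product of L2 and once for that of H^2. Degenerate
   forms have to be allowed, since both are only semi-definite on functions. *)
Lemma discriminant_le (A B C : R) : 0 <= C ->
  (forall s : R, 0 <= A + 2 * s * B + s ^+ 2 * C) -> B ^+ 2 <= A * C.
Proof.
move=> C0 q; have [C_eq0|Cn0] := eqVneq C 0; last first.
  have Cgt0 : 0 < C by rewrite lt_def Cn0.
  have := q (- B / C).
  rewrite (_ : _ + _ = (A * C - B ^+ 2) / C); last by field.
  by rewrite pmulr_lge0 ?invr_gt0// subr_ge0.
rewrite C_eq0 mulr0; have [->|Bn0] := eqVneq B 0; first by rewrite expr0n.
have := q (- (A + 1) / (2 * B)); rewrite C_eq0 mulr0 addr0.
rewrite (_ : _ + _ = -1); last by field.
by rewrite ler0N1.
Qed.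

Lemma cauchy_schwarz f h : L2 f -> L2 h -> `|dot f h| <= nrm f * nrm h.
Proof.
move=> Lf Lh.
rewrite -(@ler_pXn2r _ 2)// ?nnegrE ?mulr_ge0 ?nrm_ge0// exprMn !sqr_nrm.
rewrite real_normK ?num_real//; apply: discriminant_le => [|s].
  exact: dot_ge0.
have := dot_ge0 (f \+ (s \*o h)); have Lsh := L2Z s Lh.
rewrite dotDl ?dotDr ?dotZl ?dotZr ?(dotC h f)//; last exact: L2D.
by congr (0 <= _); ring.
Qed.

Lemma nrmD f h : L2 f -> L2 h -> nrm (f \+ h) <= nrm f + nrm h.
Proof.
move=> Lf Lh.
rewrite -(@ler_pXn2r _ 2)// ?nnegrE ?addr_ge0 ?nrm_ge0//.
rewrite sqr_nrm dotDl ?dotDr//; last exact: L2D.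
have := cauchy_schwarz Lf Lh; have := ler_norm (dot f h).
by rewrite (dotC h f) sqrrD !sqr_nrm; lra.
Qed.

Lemma nrmZ (c : R) f : L2 f -> nrm (c \*o f) = `|c| * nrm f.
Proof.
move=> Lf; rewrite /L2_norm dotZl ?dotZr//; last exact: L2Z.
by rewrite mulrA -expr2 sqrtrM ?sqr_ge0// sqrtr_sqr.
Qed.

Lemma nrm_eq0_dot f h : L2 f -> L2 h -> nrm f = 0 -> dot f h = 0.
Proof.
move=> Lf Lh f0; apply/eqP; rewrite -normr_le0.
by rewrite (le_trans (cauchy_schwarz Lf Lh))// f0 mul0r.
Qed.

Lemma nrm_le_sup f (M : R) : g0 <= g1 -> measurable_fun I f ->
  (forall t, I t -> `|f t| <= M) -> nrm f <= M * Num.sqrt (g1 - g0).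
Proof.
move=> g01 mf fM.
have Ig0 : I g0 by rewrite /= in_itv/= lexx g01.
have M0 : 0 <= M := le_trans (normr_ge0 _) (fM _ Ig0).
have Lf := bounded_L2 mf fM.
rewrite -(@ler_pXn2r _ 2)// ?nnegrE ?mulr_ge0 ?nrm_ge0 ?sqrtr_ge0//.
rewrite sqr_nrm exprMn sqr_sqrtr ?subr_ge0//.
have -> : M ^+ 2 * (g1 - g0) = \int[mu]_(t in I) (M ^+ 2).
  rewrite Rintegral_cst//; congr (_ * _); apply/esym.
  rewrite [X in fine X](_ : _ = (g1 - g0)%:E)//.
  transitivity (mu I) => //; rewrite lebesgue_measure_itv/= lte_fin.
  have [g01'|g10|->] := ltgtP g0 g1; rewrite ?subrr//.
  by rewrite leNgt g10 in g01.
apply: le_Rintegral => //.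
- exact: L2_dot_integrable.
- exact: (L2_sqr_integrable (L2_cst M)).
- move=> t It; rewrite -expr2 -[leLHS]ger0_norm ?sqr_ge0// normrX.
  by rewrite ler_pXn2r ?nnegrE ?fM.
Qed.

End L2_space.

(** * Smoothing by means over short intervals *)

Section Steklov.
Context {R : realType}.
Local Notation mu := (@lebesgue_measure R).
Implicit Types (m : R -> R) (a b c d t : R).

(** Integrating from minus infinity gives an antiderivative that is
   differentiable on the whole line. *)
Lemma compact_support_antiderivative m a b : continuous m ->
  (forall t, t \notin `[a, b] -> m t = 0) ->
  exists M : R -> R, forall t, is_derive t 1 M (m t).
Proof.
move=> cm m0; exists (fun t => \int[mu]_(s in `]-oo, t]) m s) => t.
have im : mu.-integrable `]-oo, (t + 1)] (EFin \o m).
  have -> : EFin \o m = (EFin \o m) \_ `[a, b].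
    apply/funext => s; rewrite patchE /=; case: ifPn => //.
    by rewrite notin_setE/= => /negP /m0 ->.
  apply/integrable_restrict => //.
  apply: (@integrableS _ _ _ mu `[a, b]) => //; first exact: measurableI.
  apply: continuous_compact_integrable; first exact: segment_compact.
  exact: continuous_subspaceT.
have tt1 : t < t + 1 by rewrite ltrDl.
have [|dM Mm] := continuous_FTC1 tt1 im _ (cm t); first by rewrite ltNyr.
by apply: DeriveDef => //; rewrite -derive1E.
Qed.

(** Uniform continuity of a compactly supported function, in the form in which
   it controls the means over [t, t + eta]. *)
Lemma compact_support_modulus m c d (e : R) : continuous m ->
  (forall t, t \notin `[c, d] -> m t = 0) -> 0 < e ->
  \forall eta \near 0^'+, forall t s, t <= s <= t + eta -> `|m t - m s| <= e.
Proof.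
move=> cm m0 e0.
(* Heine-Cantor: compactness makes the local moduli of continuity uniform. The
   interval starts at [c - 1] so that, for [eta < 1], points to its left stay
   outside the support. *)
have /compact_near_coveringP K : compact (`[c - 1, d]%classic : set R).
  exact: segment_compact.
have {}K : \forall eta \near 0^'+, `[c - 1, d]%classic `<=`
    [set t | forall s, t <= s <= t + eta -> `|m t - m s| <= e].
  apply: K => x _ /=.
  have e20 : 0 < e / 2 by rewrite divr_gt0.
  have /cvgrPdist_lt /(_ _ e20)[r /= r0 mr] := cm x.
  exists (ball x (r / 2), [set eta | eta < r / 2]).
    split => /=; first by apply: nbhsx_ballx; rewrite divr_gt0.
    by apply: nbhs_right_lt; rewrite divr_gt0.
  move=> [t eta] /= [xt et] s /andP[ts ste].
  have xt2 : `|x - t| < r / 2 by [].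
  have := mr t; have := mr s; rewrite /ball_/=.
  have -> : `|x - t| < r by apply: lt_le_trans xt2 _; lra.
  have -> : `|x - s| < r.
    rewrite (_ : x - s = (x - t) + (t - s)); last by ring.
    rewrite (le_lt_trans (ler_normD _ _))//.
    have : `|t - s| < r / 2 by rewrite distrC ger0_norm ?subr_ge0//; lra.
    by lra.
  move=> /(_ isT) A /(_ isT) B.
  rewrite (_ : m t - m s = (m x - m s) - (m x - m t)); last by ring.
  rewrite (le_trans (ler_normB _ _))//; lra.
near=> eta => t s tse.
have eta1 : eta < 1 by near: eta; apply: nbhs_right_lt.
have [tcd|tcd] := boolP (t \in `[c - 1, d]).
  by move: t tcd s tse; near: eta; apply: filterS K => eta K t tcd; exact: K.
have zero u : u < c \/ d < u -> m u = 0.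
  move=> ucd; apply: m0; rewrite in_itv/= negb_and -!ltNge.
  by apply/orP.
have [t_d|d_t] := leP t d; last first.
  by rewrite !zero ?subrr ?normr0 ?(ltW e0)//; right; lra.
have tc : t < c - 1.
  by move: tcd; rewrite in_itv/= t_d andbT -ltNge.
by rewrite !zero ?subrr ?normr0 ?(ltW e0)//; left; lra.
Unshelve. all: by end_near. Qed.

(** The means of [m] over [t, t + eta] are of class C^1 and converge uniformly
   to [m] as [eta] tends to 0. *)
Lemma test_function_uniform (g0 g1 : R) m c d (e : R) : continuous m ->
  g0 < c -> d < g1 -> (forall t, t \notin `[c, d] -> m t = 0) -> 0 < e ->
  exists2 phi, test_function g0 g1 phi & forall t, `|m t - phi t| <= e.
Proof.
move=> cm g0c dg1 m0 e0.
have [M dM] := compact_support_antiderivative cm m0.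
have := compact_support_modulus cm m0 e0.
move=> modulus.
have [eta [eta0 etac {}modulus]] : exists eta : R, [/\ 0 < eta, eta < c - g0 &
    forall t s, t <= s <= t + eta -> `|m t - m s| <= e].
  near (0 : R)^'+ => eta; exists eta; split => //.
    by near: eta; apply: nbhs_right_lt; rewrite subr_gt0.
  by near: eta.
pose phi t := (M (t + eta) - M t) / eta.
have dphi t : is_derive t 1 phi ((m (t + eta) - m t) / eta).
  have dMs : is_derive t 1 (M \o shift eta) (m (t + eta) * 1).
    apply: is_derive1_comp; exact: is_derive_shift.
  have := is_deriveZ eta^-1 (is_deriveB dMs (dM t)).
  rewrite mulr1 /GRing.scale/= [X in is_derive _ _ _ X -> _]mulrC.
  by congr is_derive; apply/funext => s; rewrite /phi !fctE /= mulrC.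
have mean t : exists2 s, t <= s <= t + eta & phi t = m s.
  have cM : {within `[t, t + eta], continuous M}.
    apply: continuous_subspaceT => s.
    by apply/differentiable_continuous/derivable1_diffP; case: (dM s).
  have [|s] := MVT (_ : t < t + eta) (fun s _ => dM s) cM.
    by rewrite ltrDl.
  rewrite in_itv/= => /andP[/ltW ts /ltW se] E; exists s; first by rewrite ts.
  by rewrite /phi E [t + _]addrC addrK mulfK// gt_eqF.
exists phi => [|t]; last by have [s tse ->] := mean t; exact: modulus.
split.
- by move=> t; case: (dphi t).
- have -> : derive1 phi = (fun t => (m (t + eta) - m t) / eta).
    by apply/funext => t; rewrite derive1E; case: (dphi t).
  move=> t; apply: cvgM; last exact: cvg_cst.
  apply: cvgB; last exact: cm.
  apply: (@continuous_comp _ _ _ (fun t => t + eta) m); last exact: cm.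
  by apply: cvgD; [exact: cvg_id|exact: cvg_cst].
- exists (c - eta), d; split => //; first by lra.
  move=> t tcd; have [s tse ->] := mean t; apply: m0; apply: contra tcd.
  by rewrite !in_itv/=; lra.
Unshelve. all: by end_near. Qed.

End Steklov.

(** * Density of test functions *)

Section clip.
Context {R : realType}.
Implicit Types (N x y : R).

Definition clip N x : R := Num.max (- N) (Num.min x N).

Lemma clip_bound N x : 0 <= N -> `|clip N x| <= N.
Proof.
move=> N0; rewrite ler_norml /clip le_max lexx/= ge_max ge_min lexx orbT andbT.
by lra.
Qed.

Lemma clip_id N x : `|x| <= N -> clip N x = x.
Proof.
by rewrite ler_norml => /andP[Nx xN]; rewrite /clip (min_idPl xN) (max_idPr Nx).
Qed.

Lemma normr_clip N x : 0 <= N -> `|clip N x| <= `|x|.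
Proof.
move=> N0; have [xN|Nx] := leP `|x| N; first by rewrite clip_id.
by rewrite (le_trans (clip_bound _ N0))// ltW.
Qed.

Lemma clip_contract N x y : `|clip N x - clip N y| <= `|x - y|.
Proof.
have := ler_norm (x - y); have := ler_norm (y - x); rewrite (distrC y x) => A B.
rewrite ler_norml; apply/andP; rewrite /clip.
by split; have [?|?] := leP x N; have [?|?] := leP y N;
  try (have [?|?] := leP (- N) x); try (have [?|?] := leP (- N) y);
  try (have [?|?] := leP (- N) N); lra.
Qed.

Lemma continuous_clip N : continuous (clip N).
Proof.
move=> x; apply: (@continuous_max R R (cst (- N)) (fun y => Num.min y N) x).
  exact: cst_continuous.
by apply: (@continuous_min R R id (cst N) x); [exact: cvg_id|exact: cst_continuous].
Qed.

End clip.

Section density.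
Context {R : realType}.
Context (g0 g1 : R) (g01 : g0 < g1).
Local Notation mu := (@lebesgue_measure R).
Local Notation I := (`[g0, g1]%classic : set R).
Local Notation L2 := (L2 g0 g1).
Local Notation dot := (L2_dot g0 g1).
Local Notation nrm := (L2_norm g0 g1).
Implicit Types f h k : R -> R.

(** Dominated convergence in L2. Pointwise convergence is asked only inside the
   interval, because cut-off functions vanish at the end points. *)
Lemma L2_dominated f (F : nat -> R -> R) (e : R) : L2 f ->
  (forall n, measurable_fun I (F n)) ->
  (forall n t, `|F n t| <= `|f t|) ->
  (forall t, g0 < t < g1 -> \forall n \near \oo, F n t = f t) ->
  0 < e -> exists n, nrm (f \- F n) <= e.
Proof.
move=> Lf mF Ff Fcvg e0.
pose D : set R := `]g0, g1[%classic.
have mI : measurable I by exact: measurable_itv.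
have mD : measurable D by exact: measurable_itv.
have DI : D `<=` I by exact: subset_itv_oo_cc.
have mfF n : measurable_fun I (fun t => (f t - F n t) ^+ 2).
  by apply: measurable_funX; apply: measurable_funB => //; exact: (proj1 Lf).
pose G : R -> \bar R := EFin \o (fun t => ((2 \*o f) t) ^+ 2).
have iG : mu.-integrable D G.
  by apply: (@integrableS _ _ _ mu I D _ mI mD DI); exact/L2_sqr_integrable/L2Z.
have bnd n t : `|(f t - F n t) ^+ 2| <= ((2 \*o f) t) ^+ 2.
  rewrite ger0_norm ?sqr_ge0// -ler_sqrt ?sqr_ge0// !sqrtr_sqr /=.
  by rewrite (le_trans (ler_normB _ _))// normrM ger0_norm//; have := Ff n t; lra.
have /fine_cvgP[_ /cvgrPdist_le/(_ (e ^+ 2))] :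
    (\int[mu]_(t in D) ((f t - F n t) ^+ 2)%:E)%E @[n --> \oo] --> 0%:E.
  have <- : (\int[mu]_(t in D) (cst 0%E) t)%E = 0%:E by rewrite integral0.
  apply: (@dominated_cvg _ _ _ mu D mD _ _ G) => //.
  - move=> n; apply/measurable_EFinP.
    exact: (measurable_funS mI DI (mfF n)).
  - move=> t; rewrite /D/= in_itv/= => /Fcvg Ft.
    apply: cvg_near_cst; near=> n.
    by rewrite (_ : F n t = f t) ?subrr ?expr0n//; near: n.
  - by move=> n t _; rewrite lee_fin bnd.
rewrite exprn_gt0// => /(_ isT)[n _ /(_ n)/= /(_ (leqnn n))].
rewrite sub0r normrN => nD; exists n.
rewrite -(@ler_pXn2r _ 2)// ?nnegrE ?nrm_ge0 ?(ltW e0)// sqr_nrm.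
apply: le_trans nD; rewrite (le_trans _ (ler_norm _))//.
rewrite le_eqVlt; apply/orP; left; apply/eqP.
have iFI : mu.-integrable I (EFin \o (fun t => (f t - F n t) ^+ 2)).
  apply: (@le_integrable _ _ _ mu I mI _ (EFin \o (fun t => ((2 \*o f) t) ^+ 2))).
  - by apply/measurable_EFinP; exact: (mfF n).
  - by move=> t _ /=; rewrite lee_fin (le_trans (bnd n t))// ler_norm.
  - exact/L2_sqr_integrable/L2Z.
rewrite /L2_dot -(@Rintegral_itv_obnd_cbnd _ g0 (BRight g1)); last first.
  apply: (@integrableS _ _ _ mu I) iFI => //; exact: subset_itv_oc_cc.
rewrite -(@Rintegral_itv_bndo_bndc _ (BRight g0) g1); last first.
  exact: (@integrableS _ _ _ mu I D).
by apply: eq_Rintegral => t _; rewrite expr2.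
Unshelve. all: by end_near. Qed.

Lemma L2_dense_bounded f (e : R) : L2 f -> 0 < e ->
  exists2 N : R, 0 <= N & nrm (f \- (clip N \o f)) <= e.
Proof.
move=> Lf e0.
have [||||n nP] := @L2_dominated f (fun n => clip n%:R \o f) e Lf.
- move=> n; apply: measurableT_comp => //; last exact: (proj1 Lf).
  by apply: continuous_measurable_fun; exact: continuous_clip.
- by move=> n t; apply: normr_clip.
- move=> t _; exists (Num.bound `|f t|) => // n /= tn; apply: clip_id.
  by rewrite (le_trans (ltW (archi_boundP _)))// ler_nat.
- exact: e0.
- by exists n%:R.
Qed.

(** Continuous functions approximate [f] in L1. Clipping them to the bounds of
   [f] does not increase the distance, and then the square of the difference is
   at most [2 N] times the difference. *)
Lemma L2_dense_continuous f (N e : R) : measurable_fun I f ->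
  (forall t, `|f t| <= N) -> 0 < e ->
  exists h : R -> R, [/\ continuous h, forall t, `|h t| <= N & nrm (f \- h) <= e].
Proof.
move=> mf fN e0.
have mI : measurable I by exact: measurable_itv.
have N0 : 0 <= N := le_trans (normr_ge0 _) (fN 0).
have muI : (mu I < +oo)%E.
  by rewrite lebesgue_measure_itv /=; case: ifP => // _; rewrite -EFinD ltry.
have i_f : mu.-integrable I (EFin \o f).
  apply: measurable_bounded_integrable => //.
  exists N; split; rewrite ?num_real// => x Nx t _.
  exact: le_trans (fN t) (ltW Nx).
have [g [cg ig]] := approximation_continuous_integrable mI muI i_f.
(* The summand 1 keeps the denominator positive when [N = 0]. *)
pose c := e ^+ 2 / (2 * N + 1).
have c0 : 0 < c by rewrite divr_gt0 ?exprn_gt0// ltr_wpDl ?mulr_ge0.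
move=> /fine_cvgP[_ /cvgrPdist_le/(_ c c0)[n _ /(_ n (leqnn n))]].
rewrite /= sub0r normrN => gn.
have ifg : mu.-integrable I (EFin \o (fun t => `|f t - g n t|)).
  apply: (@integrable_norm _ _ _ mu I (f \- g n)).
  exact: (@integrableB _ _ _ mu I mI (EFin \o f) (EFin \o g n)).
have ch : continuous (clip N \o g n).
  by move=> t; apply: continuous_comp; [exact: cg|exact: continuous_clip].
have mh : measurable_fun I (clip N \o g n).
  by apply: subspace_continuous_measurable_fun => //; exact: continuous_subspaceT.
have hN t : `|(clip N \o g n) t| <= N by exact: clip_bound.
exists (clip N \o g n); split => //.
rewrite -(@ler_pXn2r _ 2)// ?nnegrE ?nrm_ge0 ?(ltW e0)// sqr_nrm.
have LfN : L2 f by apply: (@bounded_L2 _ _ _ _ N).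
have Lh : L2 (clip N \o g n) by apply: (@bounded_L2 _ _ _ _ N).
apply: (@le_trans _ _ (\int[mu]_(t in I) ((2 * N) * `|f t - g n t|))).
  apply: le_Rintegral => //.
  - by apply: L2_dot_integrable; exact: L2B.
  - exact: (@integrableZl _ _ _ mu I mI (2 * N) _ ifg).
  - move=> t _; rewrite -expr2 -[leLHS]ger0_norm ?sqr_ge0// normrX expr2.
    apply: ler_pM => //=; last first.
      by rewrite -{1}(clip_id (fN t)) clip_contract.
    by rewrite (le_trans (ler_normB _ _))//; have := fN t; have := hN t => /=; lra.
rewrite RintegralZl//.
apply: (@le_trans _ _ (2 * N * c)).
  rewrite ler_wpM2l ?mulr_ge0//; apply: le_trans gn.
  rewrite -[leLHS]ger0_norm; last by apply: Rintegral_ge0.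
  by [].
rewrite /c mulrA ler_pdivrMr ?ltr_wpDl ?mulr_ge0// mulrC ler_wpM2l ?sqr_ge0//.
by rewrite lerDl.
Qed.

Lemma L2_dense_compact_support h (e : R) : continuous h -> 0 < e ->
  exists m : R -> R, exists c d, [/\ continuous m, g0 < c, d < g1,
    forall t, t \notin `[c, d] -> m t = 0 & nrm (h \- m) <= e].
Proof.
move=> ch e0.
(* [w n] is 0 up to distance 1/(n+1) from the end points, and 1 from distance
   2/(n+1) on. *)
pose w (n : nat) (t : R) : R :=
  Num.max 0 (Num.min 1 (n.+1%:R * Num.min (t - g0) (g1 - t) - 1)).
have w01 n t : 0 <= w n t <= 1.
  by rewrite /w le_max lexx/= ge_max ler01/= ge_min lexx.
have cw n : continuous (w n).
  have cmin t : {for t, continuous (fun t : R => Num.min (t - g0) (g1 - t))}.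
    apply: (@continuous_min R R (fun t => t - g0) (fun t => g1 - t) t).
      by apply: cvgB; [exact: cvg_id|exact: cvg_cst].
    by apply: cvgB; [exact: cvg_cst|exact: cvg_id].
  have caff t : {for t, continuous
      (fun t : R => n.+1%:R * Num.min (t - g0) (g1 - t) - 1)}.
    by apply: cvgB; [apply: cvgM; [exact: cvg_cst|exact: cmin]|exact: cvg_cst].
  move=> t; apply: (@continuous_max R R (cst 0) (fun t =>
    Num.min 1 (n.+1%:R * Num.min (t - g0) (g1 - t) - 1)) t).
    exact: cst_continuous.
  apply: (@continuous_min R R (cst 1) (fun t =>
    n.+1%:R * Num.min (t - g0) (g1 - t) - 1) t); first exact: cst_continuous.
  exact: caff.
have chw n : continuous (fun t => w n t * h t).
  by move=> t; apply: cvgM; [exact: cw|exact: ch].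
have Lh : L2 h by apply: continuous_L2; exact: continuous_subspaceT.
have [||||n nP] := @L2_dominated h (fun n t => w n t * h t) e Lh.
- move=> n; apply: subspace_continuous_measurable_fun => //.
  exact: continuous_subspaceT.
- move=> n t; have /andP[w0 w1] := w01 n t.
  by rewrite normrM ger0_norm// ler_piMl.
- move=> t /andP[g0t tg1]; pose r := Num.min (t - g0) (g1 - t).
  have r0 : 0 < r by rewrite lt_min !subr_gt0 g0t tg1.
  exists (Num.bound (2 / r)) => // n /= rn.
  suff -> : w n t = 1 by rewrite mul1r.
  have : 2 / r <= n.+1%:R.
    rewrite (le_trans (ltW (archi_boundP _))) ?divr_ge0 ?(ltW r0)// ler_nat.
    exact: leqW.
  rewrite ler_pdivrMr// => r2; rewrite /w -/r (min_idPl _) ?(max_idPr _)//.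
  by move: r2; lra.
- exact: e0.
- have n0 : 0 < n.+1%:R^-1 :> R by rewrite invr_gt0.
  exists (fun t => w n t * h t), (g0 + n.+1%:R^-1), (g1 - n.+1%:R^-1); split => //.
  + by rewrite ltrDl.
  + by rewrite gtrDl oppr_lt0.
  + move=> t; rewrite in_itv/= negb_and -!ltNge => tcd.
    suff -> : w n t = 0 by rewrite mul0r.
    apply/max_idPl; rewrite ge_min subr_le0; apply/orP; right.
    rewrite -ler_pdivlMl// mulr1 ge_min; apply/orP.
    by move: (n.+1%:R^-1 : R) tcd => r; case/orP => tcd; [left|right]; lra.
Qed.

(** Test functions are dense in L2: truncate, approximate in L1 by a continuous
   function (which on bounded functions is as good as L2), cut off near the end
   points and take means. *)
Lemma test_function_dense f (e : R) : L2 f -> 0 < e ->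
  exists2 phi, test_function g0 g1 phi & nrm (f \- phi) <= e.
Proof.
move=> Lf e0; have e4 : 0 < e / 4 by rewrite divr_gt0.
have [N N0 fN] := L2_dense_bounded Lf e4.
have mfN : measurable_fun I (clip N \o f).
  apply: measurableT_comp => //; last exact: (proj1 Lf).
  by apply: continuous_measurable_fun; exact: continuous_clip.
have [h [ch hN fh]] := L2_dense_continuous mfN (fun t => clip_bound (f t) N0) e4.
have [m [c [d [cm g0c dg1 m0 hm]]]] := L2_dense_compact_support ch e4.
have s0 : 0 < Num.sqrt (g1 - g0) by rewrite sqrtr_gt0 subr_gt0.
have es : 0 < e / 4 / Num.sqrt (g1 - g0) by rewrite divr_gt0.
have [phi tphi mphi] := test_function_uniform cm g0c dg1 m0 es.
exists phi => //.
have cphi : continuous phi.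
  move=> t; apply/differentiable_continuous/derivable1_diffP.
  by case: tphi.
have LC k : continuous k -> L2 k.
  by move=> ck; apply: continuous_L2; exact: continuous_subspaceT.
have LfN : L2 (clip N \o f).
  by apply: (bounded_L2 mfN) => t _; exact: clip_bound.
have nmphi : nrm (m \- phi) <= e / 4.
  rewrite (le_trans (nrm_le_sup (ltW g01) _ (fun t _ => mphi t)))//.
    exact: (proj1 (L2B (LC _ cm) (LC _ cphi))).
  by rewrite divfK// gt_eqF.
have -> : f \- phi = ((f \- (clip N \o f)) \+ ((clip N \o f) \- h))
    \+ ((h \- m) \+ (m \- phi)) by apply/funext => t /=; ring.
have L1 : L2 (f \- (clip N \o f)) by exact: L2B.
have L3 : L2 ((clip N \o f) \- h) by apply: L2B => //; exact: LC.
have L4 : L2 (h \- m) by apply: L2B; exact: LC.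
have L5 : L2 (m \- phi) by apply: L2B; exact: LC.
rewrite (le_trans (nrmD (L2D L1 L3) (L2D L4 L5)))//.
rewrite (le_trans (lerD (nrmD L1 L3) (nrmD L4 L5)))//.
by lra.
Qed.

End density.

(** * Integrals of L2 functions and integration by parts *)

Section primitives.
Context {R : realType} (g0 g1 : R) (g01 : g0 < g1).
Local Notation mu := (@lebesgue_measure R).
Local Notation I := (`[g0, g1]%classic : set R).
Local Notation L2 := (L2 g0 g1).
Local Notation dot := (L2_dot g0 g1).
Local Notation nrm := (L2_norm g0 g1).
Local Notation s := (Num.sqrt (g1 - g0)).
Implicit Types (f h k u v w m : R -> R) (t : R).

Let mI : measurable I. Proof. exact: measurable_itv. Qed.

Let g0I : g0 \in `[g0, g1]. Proof. by rewrite in_itv/= lexx ltW. Qed.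
Let g1I : g1 \in `[g0, g1]. Proof. by rewrite in_itv/= lexx ltW. Qed.

(** The working description of H^1. It is insensitive to changes of [h] on null
   sets and of [u] off the interval, and it contains the continuity of [u]. *)
Definition primitive_of u h : Prop :=
  L2 h /\
  forall t, t \in `[g0, g1] -> u t = u g0 + \int[mu]_(x in `[g0, t]) h x.

Definition C1_pair u h : Prop := (forall t, is_derive t 1 u (h t)) /\ continuous h.

Lemma L2_indic t : L2 (\1_(`[g0, t]%classic : set R)).
Proof.
apply: (@bounded_L2 _ _ _ _ 1); first by apply: measurable_indic.
by move=> x _; rewrite indicE; case: (_ \in _); rewrite ?normr1 ?normr0.
Qed.

(** As a scalar product, the integral inherits linearity, the Cauchy-Schwarz
   inequality and independence of the representative. *)
Lemma Rintegral_indic t h : t \in `[g0, g1] ->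
  \int[mu]_(x in `[g0, t]) h x = dot h (\1_(`[g0, t]%classic : set R)).
Proof.
rewrite in_itv/= => /andP[g0t tg1].
have -> : (`[g0, t]%classic : set R) = I `&` `[g0, t]%classic.
  by apply/esym/setIidPr; apply: subset_itvl; rewrite bnd_simp.
rewrite Rintegral_mkcondr; apply: eq_Rintegral => x xI.
rewrite patchE indicE in_setI xI/=.
by case: ifP; rewrite ?mulr1 ?mulr0.
Qed.

Lemma Rintegral_bound t h : t \in `[g0, g1] -> L2 h ->
  `|\int[mu]_(x in `[g0, t]) h x| <= nrm h * s.
Proof.
move=> tI Lh; rewrite Rintegral_indic//.
rewrite (le_trans (cauchy_schwarz Lh (L2_indic t)))// ler_wpM2l ?nrm_ge0//.
rewrite -[leRHS]mul1r; apply: nrm_le_sup; first exact: ltW.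
  exact: (proj1 (L2_indic t)).
by move=> x _; rewrite indicE; case: (_ \in _); rewrite ?normr1 ?normr0.
Qed.

Lemma Rintegral_point h : \int[mu]_(x in `[g0, g0]) h x = 0.
Proof. by rewrite set_itv1 Rintegral_set1. Qed.

Lemma primitive_of_Rintegral h : L2 h ->
  primitive_of (fun t => \int[mu]_(x in `[g0, t]) h x) h.
Proof. by move=> Lh; split => // t _; rewrite Rintegral_point add0r. Qed.

Lemma L2_integrable h : L2 h -> mu.-integrable I (EFin \o h).
Proof.
move=> Lh; have := L2_dot_integrable Lh (L2_cst g0 g1 1).
by congr (mu.-integrable _ _); apply/funext => t /=; rewrite mulr1.
Qed.

Lemma primitive_continuous u h : primitive_of u h -> {within I, continuous u}.
Proof.
move=> [Lh uh].
have := parameterized_integral_continuous (ltW g01) (L2_integrable Lh).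
move=> ch; apply: (@subspace_eq_continuous _ I _
    (fun t => u g0 + parameterized_integral mu g0 t h)).
  by move=> t /set_mem tI; rewrite [RHS]uh.
by move=> t; apply: cvgD; [exact: cvg_cst|exact: ch].
Qed.

Lemma primitive_L2 u h : primitive_of u h -> L2 u.
Proof. by move/primitive_continuous/continuous_L2. Qed.

Lemma primitiveZ (c : R) u h : primitive_of u h ->
  primitive_of (c \*o u) (c \*o h).
Proof.
move=> [Lh uh]; split; first exact: L2Z.
move=> t tI; rewrite Rintegral_indic// dotZl//; last exact: L2_indic.
by rewrite /= uh// !Rintegral_indic//; ring.
Qed.

Lemma primitiveB u h v k : primitive_of u h -> primitive_of v k ->
  primitive_of (u \- v) (h \- k).
Proof.
move=> [Lh uh] [Lk vk]; split; first exact: L2B.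
move=> t tI; rewrite Rintegral_indic// dotBl//; last exact: L2_indic.
by rewrite /= uh// vk// !Rintegral_indic//; ring.
Qed.

Lemma eq_primitive u v h k : {in `[g0, g1], u =1 v} -> L2 k ->
  nrm (h \- k) = 0 -> primitive_of u h -> primitive_of v k.
Proof.
move=> uv Lk hk0 [Lh uh]; split => // t tI.
rewrite -!uv// uh//; congr (_ + _); rewrite !Rintegral_indic//.
apply/eqP; rewrite -subr_eq0 -dotBl//; last exact: L2_indic.
by rewrite nrm_eq0_dot//; [exact: L2B|exact: L2_indic].
Qed.

Lemma eq_nrm0 h k : {in `[g0, g1], h =1 k} -> nrm (h \- k) = 0.
Proof.
move=> hk; rewrite /L2_norm (@eq_dot _ _ _ _ _ (cst 0) (cst 0)).
- rewrite /L2_dot; under eq_Rintegral do rewrite /= mulr0.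
  by rewrite Rintegral_cst// mul0r sqrtr0.
- by move=> t; rewrite inE/= => tI; rewrite hk ?subrr.
- by move=> t; rewrite inE/= => tI; rewrite hk ?subrr.
Qed.

Lemma C1_pair_continuous u h : C1_pair u h -> continuous u.
Proof.
move=> [du _] t; apply/differentiable_continuous/derivable1_diffP.
by case: (du t).
Qed.

Lemma test_function_C1 phi : test_function g0 g1 phi -> C1_pair phi (derive1 phi).
Proof.
move=> [dphi cphi _]; split => // t; apply: DeriveDef; first exact: dphi.
by rewrite derive1E.
Qed.

Lemma C1_pair_LRcontinuous u h a b : C1_pair u h -> a < b ->
  derivable_oo_LRcontinuous u a b.
Proof.
move=> uh ab; have cu := C1_pair_continuous uh; split.
- by move=> t _; case: (proj1 uh t).
- by apply: cvg_at_right_filter; exact: cu.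
- by apply: cvg_at_left_filter; exact: cu.
Qed.

Lemma C1_primitive u h : C1_pair u h -> primitive_of u h.
Proof.
move=> uh; have [du ch] := uh.
split; first by apply: continuous_L2; exact: continuous_subspaceT.
move=> t; rewrite in_itv/= => /andP[].
rewrite le_eqVlt => /predU1P[<- _|g0t tg1].
  by rewrite Rintegral_point addr0.
rewrite /Rintegral (@continuous_FTC2 _ h u g0 t)//=.
- by ring.
- exact: continuous_subspaceT.
- exact: C1_pair_LRcontinuous uh _.
- by move=> x _; rewrite derive1E; case: (du x).
Qed.

(** What integration by parts claims to be zero. *)
Definition parts_defect u h v k : R :=
  dot u k + dot h v - (u g1 * v g1 - u g0 * v g0).

Lemma parts_defectC u h v k : parts_defect u h v k = parts_defect v k u h.
Proof. by rewrite /parts_defect (dotC _ _ u) (dotC _ _ h); ring. Qed.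

Lemma parts_defect_C1 u h v k : C1_pair u h -> C1_pair v k ->
  parts_defect u h v k = 0.
Proof.
move=> uh vk; rewrite /parts_defect {1}/L2_dot.
rewrite (@Rintegration_by_parts _ u v h k)//.
- by rewrite -/(L2_dot g0 g1 h v); ring.
- by apply: continuous_subspaceT; exact: (proj2 uh).
- exact: C1_pair_LRcontinuous uh _.
- by move=> x _; rewrite derive1E; case: (proj1 uh x).
- by apply: continuous_subspaceT; exact: (proj2 vk).
- exact: C1_pair_LRcontinuous vk _.
- by move=> x _; rewrite derive1E; case: (proj1 vk x).
Qed.

Lemma le0_of_small (x K : R) : 0 <= K -> (forall e, 0 < e -> x <= K * e) -> x <= 0.
Proof.
move=> K0 xK; rewrite leNgt; apply/negP => x0.
have K1 : 0 < K + 1 by rewrite ltr_wpDl.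
have := xK (x / (K + 1)) (divr_gt0 x0 K1).
apply/negP; rewrite -ltNge mulrA ltr_pdivrMr// mulrC ltr_pM2l//.
by rewrite ltrDl.
Qed.

(** The defect is continuous in its second pair for the L2 norm of the
   derivative, so it is enough to test it on pairs of class C^1. *)
Lemma parts_defect_dense u h v k : primitive_of u h -> primitive_of v k ->
  (forall w l, C1_pair w l -> parts_defect u h w l = 0) ->
  parts_defect u h v k = 0.
Proof.
move=> uh vk uh0; have [Lh _] := uh; have [Lk _] := vk.
have Lu := primitive_L2 uh; have Lv := primitive_L2 vk.
apply/eqP; rewrite -normr_le0.
pose K := nrm u + nrm h * (s * s) + `|u g1| * s.
have s0 : 0 <= s := sqrtr_ge0 _.
have K0 : 0 <= K.
  by rewrite !addr_ge0 ?mulr_ge0 ?nrm_ge0.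
apply: (le0_of_small K0) => e e0.
have [phi tphi kphi] := test_function_dense g01 Lk e0.
have cphi := C1_pair_continuous (test_function_C1 tphi).
have [c [d [g0c dg1 phi0]]] : exists c d, [/\ g0 < c, d < g1 &
    forall t, t \notin `[c, d] -> phi t = 0] by case: tphi.
have [M dM] := compact_support_antiderivative cphi phi0.
(* [w] starts at the same value as [v], so that the L2 norm of [k - phi] bounds
   [v - w] uniformly. *)
pose w t := M t - M g0 + v g0.
have dw : C1_pair w phi.
  split => // t; rewrite -[phi t]addr0 -[X in is_derive _ _ _ (X + _)]subr0.
  by apply: is_deriveD; apply: is_deriveB.
have := uh0 _ _ dw; have pw := C1_primitive dw.
have Lw := primitive_L2 pw; have [Lphi _] := pw.
have pvw := primitiveB vk pw; have Lvw := primitive_L2 pvw.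
have vw0 : v g0 - w g0 = 0 by rewrite /w; ring.
have vw t : t \in `[g0, g1] -> `|v t - w t| <= e * s.
  move=> tI; have [_ /(_ t tI)/= ->] := pvw.
  rewrite vw0 add0r (le_trans (Rintegral_bound tI (proj1 pvw)))//.
  by rewrite ler_wpM2r.
have nvw : nrm (v \- w) <= e * s * s.
  apply: nrm_le_sup; [exact: ltW|exact: (proj1 Lvw)|by move=> t; exact: vw].
have -> : parts_defect u h v k = parts_defect u h w phi +
    (dot u (k \- phi) + dot h (v \- w) - u g1 * (v g1 - w g1)).
  have : u g0 * (v g0 - w g0) = 0 by rewrite vw0 mulr0.
  by rewrite /parts_defect !dotBr//; lra.
move=> ->; rewrite add0r (le_trans (ler_normB _ _))//.
rewrite (le_trans (lerD (ler_normD _ _) (lexx _)))// normrM.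
have := ler_wpM2l (normr_ge0 (u g1)) (vw _ g1I).
have := ler_wpM2l (nrm_ge0 g0 g1 h) nvw.
have := ler_wpM2l (nrm_ge0 g0 g1 u) kphi.
have := cauchy_schwarz Lh Lvw; have := cauchy_schwarz Lu (L2B Lk Lphi).
by rewrite /K !mulrDl; lra.
Qed.

(** Two applications of the density argument take integration by parts from
   pairs of class C^1 to arbitrary pairs. *)
Lemma integration_by_parts_primitive u h v k :
  primitive_of u h -> primitive_of v k ->
  dot u k + dot h v = u g1 * v g1 - u g0 * v g0.
Proof.
move=> uh vk; apply/eqP; rewrite -subr_eq0; apply/eqP.
apply: parts_defect_dense => // w l wl; rewrite parts_defectC.
apply: parts_defect_dense => //; first exact: C1_primitive.
by move=> w' l' wl'; exact: parts_defect_C1.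
Qed.

Lemma test_function_ends phi : test_function g0 g1 phi -> phi g0 = 0 /\ phi g1 = 0.
Proof.
move=> [_ _ [c [d [g0c dg1 phi0]]]]; split; apply: phi0; rewrite in_itv/=.
  by rewrite leNgt g0c.
by rewrite [g1 <= d]leNgt dg1 andbF.
Qed.

Lemma primitive_weak_derivative u h : primitive_of u h ->
  is_weak_derivative g0 g1 u h.
Proof.
move=> uh phi tphi; have [phi0 phi1] := test_function_ends tphi.
have := integration_by_parts_primitive uh (C1_primitive (test_function_C1 tphi)).
by rewrite phi0 phi1 !mulr0 subrr => /eqP; rewrite addr_eq0 => /eqP.
Qed.

Lemma orthogonal_test_functions f : L2 f ->
  (forall phi, test_function g0 g1 phi -> dot f phi = 0) -> nrm f = 0.
Proof.
move=> Lf f0; have [//|nf0] := eqVneq (nrm f) 0.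
have {}nf0 : 0 < nrm f by rewrite lt_def nf0 nrm_ge0.
have e0 : 0 < nrm f / 2 by rewrite divr_gt0.
have [phi tphi fphi] := test_function_dense g01 Lf e0.
have Lphi := primitive_L2 (C1_primitive (test_function_C1 tphi)).
have : nrm f ^+ 2 <= nrm f * (nrm f / 2).
  rewrite sqr_nrm -[leLHS]subr0 -(f0 _ tphi) -dotBr//.
  rewrite (le_trans (ler_norm _))//.
  rewrite (le_trans (cauchy_schwarz Lf (L2B Lf Lphi)))//.
  by rewrite ler_wpM2l// ltW.
by rewrite expr2 ler_pM2l//; lra.
Qed.

(** The integral of [f] from [g0] vanishes by the Cauchy-Schwarz inequality;
   inside the interval [f] is its derivative, and the end points follow by
   continuity. *)
Lemma continuous_nrm_eq0 f : {within I, continuous f} -> nrm f = 0 ->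
  {in `[g0, g1], f =1 cst 0}.
Proof.
move=> cf nf0; have Lf := continuous_L2 cf.
have /(continuous_within_itvP _ g01)[cfoo cf0 cf1] := cf.
have zero : {in `]g0, g1[, f =1 cst 0}.
  move=> t tI; have := tI; rewrite in_itv/= => /andP[g0t tg1].
  have [_ <-] := continuous_FTC1_closed tg1 (L2_integrable Lf) g0t (cfoo _ tI).
  rewrite derive1E (near_eq_derive _ (_ : \forall x \near t, _ = cst 0 x)).
    exact: derive_cst.
  near=> x; have xI : x \in `[g0, g1].
    rewrite in_itv/=; apply/andP; split; apply: ltW.
      by near: x; exact: lt_nbhsr.
    by near: x; exact: lt_nbhsl.
  apply/eqP; rewrite -normr_le0 (le_trans (Rintegral_bound xI Lf))//.
  by rewrite nf0 mul0r.
move=> t; rewrite in_itv/= => /andP[].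
rewrite le_eqVlt => /predU1P[<- _|g0t].
  rewrite -(cvg_lim (@Rhausdorff R) cf0); apply: (cvg_lim (@Rhausdorff R)).
  apply: cvg_near_cst; near=> x; apply: zero; rewrite in_itv/=.
  by apply/andP; split; near: x; [exact: nbhs_right_gt|exact: nbhs_right_lt].
rewrite le_eqVlt => /predU1P[->|tg1]; last by apply: zero; rewrite in_itv/= g0t.
rewrite -(cvg_lim (@Rhausdorff R) cf1); apply: (cvg_lim (@Rhausdorff R)).
apply: cvg_near_cst; near=> x; apply: zero; rewrite in_itv/=.
by apply/andP; split; near: x; [exact: nbhs_left_gt|exact: nbhs_left_lt].
Unshelve. all: by end_near. Qed.

Lemma L2_one_dot h : L2 h -> dot (cst 1) h = \int[mu]_(x in `[g0, g1]) h x.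
Proof. by move=> Lh; apply: eq_Rintegral => t _; rewrite mul1r. Qed.

(** The mean value zero makes the antiderivative that vanishes to the left of the
   support vanish to its right as well. *)
Lemma mean_zero_test_function chi c d : continuous chi -> g0 < c -> d < g1 ->
  (forall t, t \notin `[c, d] -> chi t = 0) -> dot (cst 1) chi = 0 ->
  exists2 phi, test_function g0 g1 phi & derive1 phi = chi.
Proof.
move=> cchi g0c dg1 chi0 mean0.
have [M dM] := compact_support_antiderivative cchi chi0.
have MC : C1_pair M chi by split.
have [Lchi Mint] := C1_primitive MC.
have M01 : M g1 = M g0.
  by rewrite (Mint _ g1I) -L2_one_dot// mean0 addr0.
pose phi t := M t - M g0.
have dphi t : is_derive t 1 phi (chi t).
  by rewrite -[chi t]subr0; apply: is_deriveB.
have phi' : derive1 phi = chi.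
  by apply/funext => t; rewrite derive1E; case: (dphi t).
have flat a b : a <= b -> {in `]a, b[, forall x, x \notin `[c, d]} -> M a = M b.
  move=> ab abcd.
  have [|x xab] := MVT_segment ab (fun x _ => dM x).
    apply: continuous_subspaceT; exact: C1_pair_continuous MC.
  move: ab; rewrite le_eqVlt => /predU1P[->//|ab].
  have [|y yab /eqP] := MVT ab (fun x _ => dM x).
    apply: continuous_subspaceT; exact: C1_pair_continuous MC.
  by rewrite chi0 ?abcd// mul0r subr_eq0 => /eqP ->.
exists phi => //; split.
- by move=> t; case: (dphi t).
- by rewrite phi'.
- exists c, d; split => // t; rewrite in_itv/= negb_and -!ltNge /phi.
  case/orP => [tc|dt].
    have [tg0|g0t] := leP t g0.
      rewrite (flat t g0)// ?subrr// => x; rewrite !in_itv/= => /andP[_ xg0].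
      by rewrite negb_and -!ltNge (lt_trans xg0).
    rewrite (flat g0 t) ?subrr// ?ltW// => x; rewrite !in_itv/= => /andP[_ xt].
    by rewrite negb_and -!ltNge (lt_trans xt).
  have [tg1|g1t] := leP t g1.
    rewrite (flat t g1)// ?M01 ?subrr// => x; rewrite !in_itv/= => /andP[tx _].
    by rewrite negb_and -!ltNge (lt_trans dt) ?orbT.
  rewrite -M01 (flat g1 t) ?subrr// ?ltW// => x; rewrite !in_itv/= => /andP[xt _].
  by rewrite negb_and -!ltNge (lt_trans dg1) ?orbT.
Qed.

(** Fix a test function [rho] of nonzero integral. Any test function becomes of
   mean zero, hence a derivative, after subtraction of a multiple of [rho];
   therefore [f] minus a constant is orthogonal to all test functions. *)
Lemma du_Bois_Reymond f : {within I, continuous f} ->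
  (forall phi, test_function g0 g1 phi -> dot f (derive1 phi) = 0) ->
  {in `[g0, g1], forall t, f t = f g0}.
Proof.
move=> cf f0; have Lf := continuous_L2 cf.
have L1 : L2 (cst 1) by exact: L2_cst.
have nrm1 : 0 < nrm (cst 1).
  rewrite lt_def nrm_ge0 andbT; apply/eqP => /continuous_nrm_eq0.
  have c1 : {within I, continuous (cst 1 : R -> R)}.
    by apply: continuous_subspaceT; exact: cst_continuous.
  by move=> /(_ c1 _ g0I)/eqP; rewrite /= oner_eq0.
(* A test function close enough to the constant 1 has nonzero integral. *)
have e0 : 0 < nrm (cst 1) / 2 by rewrite divr_gt0.
have [rho trho rho1] := test_function_dense g01 L1 e0.
have crho := C1_pair_continuous (test_function_C1 trho).
have Lrho : L2 rho by apply: continuous_L2; exact: continuous_subspaceT.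
have r0 : dot (cst 1) rho != 0.
  apply/eqP => r0; have : nrm (cst 1) ^+ 2 <= nrm (cst 1) * (nrm (cst 1) / 2).
    rewrite sqr_nrm -[leLHS]subr0 -r0 -dotBr//.
    rewrite (le_trans (ler_norm _))//.
    rewrite (le_trans (cauchy_schwarz L1 (L2B L1 Lrho)))//.
    by rewrite ler_wpM2l// ltW.
  by rewrite expr2 ler_pM2l//; lra.
pose M := dot f rho / dot (cst 1) rho.
have cfM : {within I, continuous (f \- cst M)}.
  by move=> t; apply: cvgB; [exact: cf|exact: cvg_cst].
have : nrm (f \- cst M) = 0.
  apply: orthogonal_test_functions; first exact: continuous_L2.
  move=> psi tpsi; have cpsi := C1_pair_continuous (test_function_C1 tpsi).
  have Lpsi : L2 psi by apply: continuous_L2; exact: continuous_subspaceT.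
  pose a := dot (cst 1) psi / dot (cst 1) rho.
  have [_ _ [c [d [g0c dg1 psi0]]]] := tpsi.
  have [_ _ [c' [d' [g0c' dg1' rho0]]]] := trho.
  have LaR : L2 (a \*o rho) by exact: L2Z.
  have [phi tphi phi'] : exists2 phi, test_function g0 g1 phi &
      derive1 phi = psi \- (a \*o rho).
    apply: (@mean_zero_test_function _ (Num.min c c') (Num.max d d')).
    - move=> t; apply: cvgB; first exact: cpsi.
      by apply: cvgM; [exact: cvg_cst|exact: crho].
    - by rewrite lt_min g0c.
    - by rewrite gt_max dg1.
    - move=> t; rewrite in_itv/= negb_and -!ltNge lt_min gt_max => tcd.
      have -> : psi t = 0.
        apply: psi0; rewrite in_itv/= negb_and -!ltNge.
        by case/orP: tcd => /andP[-> _]; rewrite ?orbT.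
      have -> : rho t = 0.
        apply: rho0; rewrite in_itv/= negb_and -!ltNge.
        by case/orP: tcd => /andP[_ ->]; rewrite ?orbT.
      by rewrite mulr0 subrr.
    - by rewrite dotBr// dotZr// /a divfK// subrr.
  have := f0 _ tphi; rewrite phi' dotBr// dotZr// => /eqP.
  rewrite subr_eq0 => /eqP E; rewrite dotBl//; last exact: L2_cst.
  have -> : (cst M : R -> R) = M \*o (cst 1 : R -> R).
    by apply/funext => t /=; rewrite mulr1.
  by rewrite dotZl// E /a /M; field.
move=> /(continuous_nrm_eq0 cfM) fM t tI.
by have := fM _ tI; have := fM _ g0I => /= /eqP + /eqP;
  rewrite !subr_eq0 => /eqP -> /eqP ->.
Qed.

(** The function and the integral of its weak derivative differ by a function of
   weak derivative zero, hence by a constant. *)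
Lemma weak_derivative_primitive u h : {within I, continuous u} -> L2 h ->
  is_weak_derivative g0 g1 u h -> primitive_of u h.
Proof.
move=> cu Lh wuh; pose U t := \int[mu]_(x in `[g0, t]) h x.
have Uh : primitive_of U h by exact: primitive_of_Rintegral.
have cU := primitive_continuous Uh.
have wU := primitive_weak_derivative Uh.
split => // t tI.
have cuU : {within I, continuous (u \- U)}.
  by move=> x; apply: cvgB; [exact: cu|exact: cU].
have flat phi : test_function g0 g1 phi -> dot (u \- U) (derive1 phi) = 0.
  move=> tphi; rewrite dotBl ?wuh ?wU ?subrr//; try exact: continuous_L2.
  apply: continuous_L2; apply: continuous_subspaceT.
  exact: (proj2 (test_function_C1 tphi)).
have Ug0 : U g0 = 0 by exact: Rintegral_point.
have := du_Bois_Reymond cuU flat tI; rewrite /= Ug0 subr0 -/(U t) => <-.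
by rewrite subrK.
Qed.

Lemma primitive_unique u h k : primitive_of u h -> primitive_of u k ->
  nrm (h \- k) = 0.
Proof.
move=> uh uk; have [Lh _] := uh; have [Lk _] := uk.
apply: orthogonal_test_functions; first exact: L2B.
move=> phi tphi; have wh := primitive_weak_derivative uh tphi.
have wk := primitive_weak_derivative uk tphi.
rewrite dotBl//; last exact: primitive_L2 (C1_primitive (test_function_C1 tphi)).
by apply/eqP; rewrite subr_eq0 -eqr_opp -wh -wk.
Qed.

End primitives.

(** * Sobolev spaces and the chosen weak derivative *)

Section sobolev.
Context {R : realType} (g0 g1 : R) (g01 : g0 < g1).
Local Notation I := (`[g0, g1]%classic : set R).
Local Notation L2 := (L2 g0 g1).
Local Notation dot := (L2_dot g0 g1).
Local Notation nrm := (L2_norm g0 g1).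
Local Notation wderiv := (wderiv g0 g1).
Local Notation sobolev := (sobolev g0 g1).
Local Notation primitive_of := (primitive_of g0 g1).
Implicit Types (f h k u v w : R -> R) (t : R).

Let D u : set (R -> R) := [set h | L2 h /\ is_weak_derivative g0 g1 u h].
Let CD u := D u `&` [set h | {within I, continuous h}].

Let wderivE u : wderiv u = xget (xget (fun=> 0) (D u)) (CD u).
Proof. by []. Qed.

Let D_wderiv u h : primitive_of u h -> D u (wderiv u).
Proof.
move=> uh; rewrite wderivE; case: (xgetP (xget (fun=> 0) (D u)) (CD u)) => [y _ []//|_].
apply: xgetPex; exists h; split; first exact: (proj1 uh).
exact: primitive_weak_derivative.
Qed.

Lemma primitive_wderiv u h : primitive_of u h -> primitive_of u (wderiv u).
Proof.
move=> uh; have [Lw ww] := D_wderiv uh.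
by apply: weak_derivative_primitive => //; exact: primitive_continuous uh.
Qed.

Lemma nrm_wderiv u h : primitive_of u h -> nrm (wderiv u \- h) = 0.
Proof. by move=> uh; exact: primitive_unique (primitive_wderiv uh) uh. Qed.

(** The choice made by [wderiv] prefers continuous weak derivatives, and on the
   interval there is at most one of these. This gives a meaning to point values
   of [wderiv]. *)
Lemma wderiv_continuous u h : primitive_of u h -> {within I, continuous h} ->
  {in `[g0, g1], wderiv u =1 h}.
Proof.
move=> uh ch; have cw : {within I, continuous (wderiv u)}.
  rewrite wderivE.
  have [_ cw] : CD u (xget (xget (fun=> 0) (D u)) (CD u)); last exact: cw.
  apply: xgetPex; exists h; split => //; split; first exact: (proj1 uh).
  exact: primitive_weak_derivative.
have c : {within I, continuous (wderiv u \- h)}.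
  by move=> t; apply: cvgB; [exact: cw|exact: ch].
move=> t tI; apply/eqP; rewrite -subr_eq0; apply/eqP.
exact: (continuous_nrm_eq0 g01 c (nrm_wderiv uh) tI).
Qed.

Lemma eq_wderiv u v : {in `[g0, g1], u =1 v} -> wderiv u = wderiv v.
Proof.
move=> uv; have uv' : {in I, u =1 v}.
  by move=> t; rewrite inE => /uv.
have DE : D u = D v.
  apply/seteqP; split => h [Lh wh]; split => // phi tphi; rewrite -(wh phi tphi).
    by apply: eq_dot => // t tI; rewrite uv'.
  by apply: eq_dot => // t tI; rewrite uv'.
by rewrite !wderivE /CD DE.
Qed.

Lemma eq_sobolev n u v : {in `[g0, g1], u =1 v} -> sobolev n u -> sobolev n v.
Proof.
move=> uv; have uv' : {in I, u =1 v}.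
  by move=> t; rewrite inE => /uv.
case: n => [|n]; first exact: eq_L2.
move=> [Lu cu [h wh sh]]; split; first exact: eq_L2 Lu.
- exact: subspace_eq_continuous cu.
- exists h => // phi tphi; rewrite -(wh phi tphi).
  by apply: eq_dot => // t tI; rewrite uv'.
Qed.

Lemma sobolev_L2 n u : sobolev n u -> L2 u.
Proof. by case: n => // n []. Qed.

Lemma sobolevS n u : sobolev n.+1 u ->
  primitive_of u (wderiv u) /\ sobolev n (wderiv u).
Proof.
move=> [Lu cu [h wh sh]].
have uh : primitive_of u h.
  by apply: weak_derivative_primitive => //; exact: sobolev_L2 sh.
have uw := primitive_wderiv uh; split => //.
case: n sh => [_|n sh]; first exact: (proj1 uw).
apply: (@eq_sobolev n.+1 h _ _ sh) => t tI; apply/esym/wderiv_continuous => //.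
by case: sh.
Qed.

Lemma primitive_sobolev n u h : primitive_of u h -> sobolev n h -> sobolev n.+1 u.
Proof.
move=> uh sh; split.
- exact: primitive_L2 uh.
- exact: primitive_continuous uh.
- by exists h => //; exact: primitive_weak_derivative.
Qed.

Lemma dot_null f h k : L2 f -> L2 h -> L2 k -> nrm (f \- h) = 0 -> dot f k = dot h k.
Proof.
move=> Lf Lh Lk fh; apply/eqP; rewrite -subr_eq0 -dotBl//.
by rewrite nrm_eq0_dot//; exact: L2B.
Qed.

Lemma dot_wderiv u h : primitive_of u h ->
  dot (wderiv u) (wderiv u) = dot h h.
Proof.
move=> uh; have [Lh _] := uh; have [Lw _] := primitive_wderiv uh.
have wh := nrm_wderiv uh.
by rewrite (dot_null Lw Lh Lw)// dotC (dot_null Lw Lh Lh).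
Qed.

Lemma primitive_wderivS u h k : primitive_of u h -> primitive_of h k ->
  primitive_of (wderiv u) k.
Proof.
move=> uh hk; apply: (@eq_primitive _ _ _ g01 h _ k) => //.
- move=> t tI; apply/esym/wderiv_continuous => //; exact: primitive_continuous hk.
- exact: (proj1 hk).
- exact: eq_nrm0.
Qed.

Lemma sobolev_norm1E u h : primitive_of u h ->
  sobolev_norm g0 g1 1 u = Num.sqrt (dot u u + dot h h).
Proof.
move=> uh; rewrite /sobolev_norm /sobolev_dot !big_ord_recr big_ord0/= add0r.
by rewrite (dot_wderiv uh).
Qed.

(** The H^2 norm of a function with successive derivatives [f], [h], [k]. As a
   function of the triple it is a seminorm on a space where these derivatives need
   not be related, which makes its triangle inequality elementary. *)
Definition norm3 f h k : R := Num.sqrt (dot f f + dot h h + dot k k).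

Lemma sobolev_norm2E u h k : primitive_of u h -> primitive_of h k ->
  sobolev_norm g0 g1 2 u = norm3 u h k.
Proof.
move=> uh hk; rewrite /sobolev_norm /sobolev_dot !big_ord_recr big_ord0/= add0r.
by rewrite (dot_wderiv uh) (dot_wderiv (primitive_wderivS uh hk)).
Qed.

Lemma sobolev_dot2_eqr u v w : {in `[g0, g1], u =1 v} ->
  sobolev_dot g0 g1 2 w u = sobolev_dot g0 g1 2 w v.
Proof.
move=> uv; rewrite /sobolev_dot !big_ord_recr !big_ord0/= (eq_wderiv uv).
congr (_ + _ + _ + _); apply: eq_dot => // t; rewrite inE/= => tI.
exact: uv.
Qed.

Lemma norm3_ge0 f h k : 0 <= norm3 f h k. Proof. exact: sqrtr_ge0. Qed.

Lemma sqr_norm3 f h k : norm3 f h k ^+ 2 = dot f f + dot h h + dot k k.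
Proof. by rewrite sqr_sqrtr// !addr_ge0 ?dot_ge0. Qed.

Lemma nrm_le_norm3 f h k :
  [/\ nrm f <= norm3 f h k, nrm h <= norm3 f h k & nrm k <= norm3 f h k].
Proof.
have A := dot_ge0 g0 g1 f; have B := dot_ge0 g0 g1 h; have C := dot_ge0 g0 g1 k.
by split; apply: ler_wsqrtr; lra.
Qed.

Lemma norm3Z (c : R) f h k : L2 f -> L2 h -> L2 k ->
  norm3 (c \*o f) (c \*o h) (c \*o k) = `|c| * norm3 f h k.
Proof.
move=> Lf Lh Lk; rewrite /norm3 !dotZl ?dotZr//; try exact: L2Z.
by rewrite -sqrtr_sqr -sqrtrM ?sqr_ge0//; congr Num.sqrt; ring.
Qed.

Lemma norm3D f h k f' h' k' : L2 f -> L2 h -> L2 k -> L2 f' -> L2 h' -> L2 k' ->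
  norm3 (f \+ f') (h \+ h') (k \+ k') <= norm3 f h k + norm3 f' h' k'.
Proof.
move=> Lf Lh Lk Lf' Lh' Lk'.
pose B := dot f f' + dot h h' + dot k k'.
have sqrDZ s : norm3 (f \+ (s \*o f')) (h \+ (s \*o h')) (k \+ (s \*o k')) ^+ 2 =
    norm3 f h k ^+ 2 + 2 * s * B + s ^+ 2 * norm3 f' h' k' ^+ 2.
  have Z u : L2 u -> L2 (s \*o u) by exact: L2Z.
  have Z' u v : L2 u -> L2 v -> L2 (u \+ (s \*o v)).
    by move=> Lu Lv; exact/L2D/Z.
  rewrite !sqr_norm3 !dotDl ?dotDr ?dotZl ?dotZr//; do ?[exact: Z|exact: Z'].
  by rewrite (dotC _ _ f') (dotC _ _ h') (dotC _ _ k') /B; ring.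
have CS : B ^+ 2 <= norm3 f h k ^+ 2 * norm3 f' h' k' ^+ 2.
  apply: discriminant_le => [|y]; first exact: sqr_ge0.
  by rewrite -sqrDZ sqr_ge0.
have := sqrDZ 1; have one u : 1 \*o u = u by apply/funext => t /=; rewrite mul1r.
rewrite !one => E.
rewrite -(@ler_pXn2r _ 2)// ?nnegrE ?addr_ge0 ?norm3_ge0// E.
have {}CS : B <= norm3 f h k * norm3 f' h' k'.
  rewrite (le_trans (ler_norm _))// -(@ler_pXn2r _ 2)// ?nnegrE ?mulr_ge0 ?norm3_ge0//.
  by rewrite real_normK ?num_real// exprMn.
by rewrite sqrrD; lra.
Qed.

Lemma norm3B f h k f' h' k' : L2 f -> L2 h -> L2 k -> L2 f' -> L2 h' -> L2 k' ->
  norm3 (f \- f') (h \- h') (k \- k') <= norm3 f h k + norm3 f' h' k'.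
Proof.
move=> Lf Lh Lk Lf' Lh' Lk'.
have opp u v : u \- v = u \+ (-1 \*o v) by apply/funext => t /=; rewrite mulN1r.
rewrite !opp (le_trans (norm3D _ _ _ _ _ _))//; try exact: L2Z.
by rewrite norm3Z// normrN1 mul1r.
Qed.

(** The values of an H^1 function are controlled by its norm: integrate by
   parts against the affine function that vanishes at the other end point. *)
Lemma trace_bound u h : primitive_of u h ->
  `|u g0| * (g1 - g0) <= nrm u * nrm (cst 1) + nrm h * nrm (fun t => t - g1) /\
  `|u g1| * (g1 - g0) <= nrm u * nrm (cst 1) + nrm h * nrm (fun t => t - g0).
Proof.
move=> uh; have Lu := primitive_L2 g01 uh; have [Lh _] := uh.
have aff (c : R) : C1_pair (fun t => t - c) (cst 1).
  split; last exact: cst_continuous.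
  by move=> t; rewrite -[cst 1 t]subr0; apply: is_deriveB.
have L1 : L2 (cst 1) by exact: L2_cst.
have La c := primitive_L2 g01 (C1_primitive g0 g1 (aff c)).
have ibp c := integration_by_parts_primitive g01 uh (C1_primitive g0 g1 (aff c)).
have bound c : `|dot u (cst 1) + dot h (fun t => t - c)| <=
    nrm u * nrm (cst 1) + nrm h * nrm (fun t => t - c).
  rewrite (le_trans (ler_normD _ _))//.
  by rewrite lerD// cauchy_schwarz//; exact: La.
split; [have := bound g1|have := bound g0]; rewrite ibp subrr mulr0.
  by rewrite sub0r normrN normrM (distrC g0) [`|g1 - g0|]gtr0_norm ?subr_gt0.
by rewrite subr0 normrM [`|g1 - g0|]gtr0_norm ?subr_gt0.
Qed.

End sobolev.

(** * The regularized solution and the energy identity of the error *)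

Section regularization.
Context {R : realType} (g0 g1 : R) (g01 : g0 < g1).
Local Notation mu := (@lebesgue_measure R).
Local Notation I := (`[g0, g1]%classic : set R).
Local Notation L2 := (L2 g0 g1).
Local Notation dot := (L2_dot g0 g1).
Local Notation nrm := (L2_norm g0 g1).
Local Notation wderiv := (wderiv g0 g1).
Local Notation sobolev := (sobolev g0 g1).
Local Notation primitive_of := (primitive_of g0 g1).
Local Notation norm3 := (norm3 g0 g1).
Implicit Types (f h k u v w : R -> R) (t alpha : R).

Let g0I : g0 \in `[g0, g1]. Proof. by rewrite in_itv/= lexx ltW. Qed.
Let g1I : g1 \in `[g0, g1]. Proof. by rewrite in_itv/= lexx ltW. Qed.

(** [T2 alpha] has dense range: a function [e] orthogonal to the range is in
   particular orthogonal to [T2 alpha w], where [w''] is [e] itself, and this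
   reads [- |w'|^2 - alpha |e|^2 = 0]. *)
Lemma orthogonal_range_T2 alpha e : 0 < alpha -> L2 e ->
  (forall w, W2 g0 g1 w -> dot (T2 g0 g1 alpha w) e = 0) -> nrm e = 0.
Proof.
move=> a0 Le orth.
pose c := \int[mu]_(x in `[g0, g1]) e x.
pose w1 t := \int[mu]_(x in `[g0, t]) e x - c.
have pw1 : primitive_of w1 e.
  split => // t tI; rewrite /w1 Rintegral_point; ring.
have cw1 := primitive_continuous g01 pw1.
have Lw1 := primitive_L2 g01 pw1.
pose w t := \int[mu]_(x in `[g0, t]) w1 x.
have pw : primitive_of w w1 by exact: primitive_of_Rintegral.
have Lw := primitive_L2 g01 pw.
have w0 : w g0 = 0 by exact: Rintegral_point.
have w11 : w1 g1 = 0 by rewrite /w1 subrr.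
have W2w : W2 g0 g1 w.
  split => //; last by rewrite (wderiv_continuous g01 pw cw1 g1I).
  have sw1 : sobolev 1 w1 by exact: (@primitive_sobolev _ _ _ g01 0 _ _ pw1 Le).
  exact: primitive_sobolev pw sw1.
have pww := primitive_wderivS g01 pw pw1.
have [Lww _] := primitive_wderiv g01 pww.
have := orth _ W2w; rewrite (_ : T2 _ _ _ _ = w \- (alpha \*o wderiv (wderiv w)))//.
rewrite dotBl ?dotZl//; last exact: L2Z.
rewrite (dot_null Lww Le Le (nrm_wderiv g01 pww)).
have := integration_by_parts_primitive g01 pw pw1.
rewrite w0 w11 mulr0 mul0r subrr => ibp eq0.
have w1ge0 := dot_ge0 g0 g1 w1; have ege0 := dot_ge0 g0 g1 e.
have : alpha * dot e e <= 0 by lra.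
rewrite pmulr_rle0// => e_le0.
by apply/eqP; rewrite /L2_norm sqrtr_eq0.
Qed.

(** The normal equation says that the residual is orthogonal to the range of
   [T2 alpha], which is dense. *)
Lemma normal_equation_solution alpha zeta b : 0 < alpha -> L2 zeta ->
  W2 g0 g1 b -> normal_equation g0 g1 alpha zeta b ->
  nrm (T2 g0 g1 alpha b \- zeta) = 0.
Proof.
move=> a0 Lz [sb _ _] [Ts [_ adj] eqTs].
have [pb /(sobolevS g01)[pb1 _]] := sobolevS g01 sb.
have LT w : sobolev 2 w -> L2 (T2 g0 g1 alpha w).
  move=> sw; have [pw /(sobolevS g01)[pw1 _]] := sobolevS g01 sw.
  apply: (@L2B _ _ _ w (alpha \*o wderiv (wderiv w))).
    exact: primitive_L2 pw.
  exact/L2Z/(proj1 pw1).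
apply: (orthogonal_range_T2 a0); first exact: L2B (LT _ sb) Lz.
move=> w Ww; have [sw _ _] := Ww.
rewrite dotBr//; try exact: LT.
rewrite (adj _ _ Ww (LT _ sb)) (adj _ _ Ww Lz).
by rewrite (sobolev_dot2_eqr _ eqTs) subrr.
Qed.

(** Solving [b - alpha b'' = zeta] for [b''] replaces a weak derivative, known up to
   null sets, by a continuous function that can be differentiated further. *)
Lemma regularized_solution alpha zeta b b1 b2 : 0 < alpha -> L2 zeta -> L2 b ->
  primitive_of b1 b2 -> nrm ((b \- (alpha \*o b2)) \- zeta) = 0 ->
  primitive_of b1 (alpha^-1 \*o (b \- zeta)).
Proof.
move=> a0 Lz Lb pb1 eq0; have [Lb2 _] := pb1.
apply: (@eq_primitive _ _ _ g01 b1 _ b2) => //; first exact/L2Z/L2B.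
have -> : b2 \- (alpha^-1 \*o (b \- zeta)) =
    - alpha^-1 \*o ((b \- (alpha \*o b2)) \- zeta).
  by apply/funext => t /=; field; rewrite gt_eqF.
by rewrite nrmZ ?eq0 ?mulr0//; apply: L2B => //; apply: L2B => //; exact: L2Z.
Qed.

(** The boundary conditions make the cross term in the square of [w - alpha w'']
   equal to [2 alpha |w'|^2], and each of [1], [2 alpha] and [alpha^2] is at least
   [alpha^2]. *)
Lemma energy_estimate alpha w w1 w2 : 0 < alpha <= 1 ->
  primitive_of w w1 -> primitive_of w1 w2 -> w g0 = 0 -> w1 g1 = 0 ->
  alpha * norm3 w w1 w2 <= nrm (w \- (alpha \*o w2)).
Proof.
move=> /andP[a0 a1] pw pw1 w0 w10.
have Lw := primitive_L2 g01 pw; have [Lw1 _] := pw; have [Lw2 _] := pw1.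
have := integration_by_parts_primitive g01 pw pw1.
rewrite w0 w10 mulr0 mul0r subrr => ibp.
rewrite -(@ler_pXn2r _ 2)// ?nnegrE ?mulr_ge0 ?nrm_ge0 ?norm3_ge0 ?(ltW a0)//.
have Law2 := L2Z alpha Lw2.
rewrite exprMn sqr_norm3 sqr_nrm dotBl ?dotBr ?dotZl ?dotZr//; last exact: L2B.
rewrite (dotC _ _ w2 w).
have A := dot_ge0 g0 g1 w; have B := dot_ge0 g0 g1 w1; have C := dot_ge0 g0 g1 w2.
have aa : alpha ^+ 2 <= alpha by rewrite expr2 ler_piMl ?(ltW a0).
have aA : alpha ^+ 2 * dot w w <= dot w w.
  by rewrite ler_piMl// (le_trans aa).
have aB : alpha ^+ 2 * dot w1 w1 <= alpha * dot w1 w1 by rewrite ler_wpM2r.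
have B' : 0 <= alpha * dot w1 w1 by rewrite mulr_ge0 ?(ltW a0).
have -> : dot w w2 = - dot w1 w1 by lra.
by lra.
Qed.

Section error.
Context (alpha : R) (zeta a f b b1 : R -> R).
Context (alpha0 : 0 < alpha) (pzeta : primitive_of zeta a) (pa : primitive_of a f)
  (pb : primitive_of b b1) (pb1 : primitive_of b1 (alpha^-1 \*o (b \- zeta)))
  (b0 : b g0 = zeta g0) (b11 : b1 g1 = a g1).
Local Notation b2 := (alpha^-1 \*o (b \- zeta)).
Local Notation e := (a \- b1).
Local Notation d := (f \- b2).

Lemma error_primitive : primitive_of e d. Proof. exact: primitiveB. Qed.

(** As [b2] is [(b - zeta) / alpha], its derivative is a multiple of the error; the
   error is thus governed by a first order system for [e] and [b2]. *)
Lemma error_primitive_b2 : primitive_of b2 (- alpha^-1 \*o e).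
Proof.
have := primitiveZ alpha^-1 (primitiveB pb pzeta).
by congr primitive_of; apply/funext => t /=; ring.
Qed.

Let Lf : L2 f. Proof. exact: (proj1 pa). Qed.
Let Lb2 : L2 b2. Proof. exact: (proj1 pb1). Qed.
Let Le : L2 e. Proof. exact: (primitive_L2 g01 error_primitive). Qed.
Let Ld : L2 d. Proof. exact: L2B. Qed.

(** Integrate [d b2] by parts; the boundary terms vanish because [e] is zero at
   [g1] and [b2] is zero at [g0]. *)
Lemma error_energy : dot e e + alpha * dot d d = alpha * dot d f.
Proof.
have := integration_by_parts_primitive g01 error_primitive error_primitive_b2.
have -> : e g1 = 0 by rewrite /= b11 subrr.
have -> : b2 g0 = 0 by rewrite /= b0 subrr mulr0.
rewrite mul0r mulr0 subrr dotZr// => E.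
have : dot d d = dot d f - dot d b2 by rewrite -dotBr.
move=> ->; have -> : dot d b2 = alpha^-1 * dot e e by lra.
by field; rewrite gt_eqF.
Qed.

Lemma error_derivative_sqr : nrm d ^+ 2 <= dot d f.
Proof.
rewrite sqr_nrm -(ler_pM2l alpha0) -error_energy.
by rewrite lerDr dot_ge0.
Qed.

Lemma error_derivative : nrm d <= nrm f.
Proof.
have [->|d0] := eqVneq (nrm d) 0; first exact: nrm_ge0.
have {}d0 : 0 < nrm d by rewrite lt_def d0 nrm_ge0.
rewrite -(ler_pM2l d0) -expr2 (le_trans error_derivative_sqr)//.
by rewrite (le_trans (ler_norm _))// cauchy_schwarz.
Qed.

Lemma error_L2 : nrm e <= Num.sqrt alpha * nrm f.
Proof.
rewrite -(@ler_pXn2r _ 2)// ?nnegrE ?mulr_ge0 ?nrm_ge0 ?sqrtr_ge0//.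
rewrite sqr_nrm exprMn sqr_sqrtr ?(ltW alpha0)//.
apply: (@le_trans _ _ (alpha * dot d f)).
  by rewrite -error_energy lerDl mulr_ge0 ?dot_ge0 ?(ltW alpha0).
rewrite ler_pM2l// (le_trans (ler_norm _))// (le_trans (cauchy_schwarz Ld Lf))//.
by rewrite expr2 ler_wpM2r ?nrm_ge0 ?error_derivative.
Qed.

(** The error tends to zero in L2 while its derivative stays bounded, so the
   derivative tends weakly to zero; [error_derivative_sqr] makes this strong. *)
Lemma error_H1 phi eps : test_function g0 g1 phi -> nrm (f \- phi) <= eps ->
  dot e e + dot d d <= alpha * nrm f ^+ 2 +
    (Num.sqrt alpha * nrm f * nrm (derive1 phi) + nrm f * eps).
Proof.
move=> tphi fphi; have cphi := test_function_C1 tphi.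
have [Lphi' _] := C1_primitive g0 g1 cphi.
have Lphi := primitive_L2 g01 (C1_primitive g0 g1 cphi).
apply: lerD.
  have -> : alpha * nrm f ^+ 2 = (Num.sqrt alpha * nrm f) ^+ 2.
    by rewrite exprMn (sqr_sqrtr (ltW alpha0)).
  rewrite -sqr_nrm ler_pXn2r// ?nnegrE ?mulr_ge0 ?nrm_ge0 ?sqrtr_ge0//.
  exact: error_L2.
rewrite -sqr_nrm (le_trans error_derivative_sqr)//.
have -> : dot d f = dot d phi + dot d (f \- phi).
  by rewrite dotBr//; ring.
apply: lerD; last first.
  rewrite (le_trans (ler_norm _))// (le_trans (cauchy_schwarz Ld (L2B Lf Lphi)))//.
  by rewrite ler_pM ?nrm_ge0 ?error_derivative.
have -> : dot d phi = - dot e (derive1 phi).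
  by rewrite (primitive_weak_derivative g01 error_primitive tphi) opprK.
rewrite (le_trans (ler_norm _))// normrN (le_trans (cauchy_schwarz Le Lphi'))//.
by rewrite ler_wpM2r ?nrm_ge0 ?error_L2.
Qed.

End error.

(** * The boundary correction and the constant of the higher order estimate *)

Section boundary_correction.
Context (alpha : R) (alpha0 : 0 < alpha).
Local Notation r := (Num.sqrt alpha).
Local Notation E := (fun t : R => expR (t / r)).

Let r0 : 0 < r. Proof. by rewrite sqrtr_gt0. Qed.

(** The solution of [y = alpha y''] with [y' g1 = p] and [y g0 = q], and after it
   the derivative of this solution. *)
Definition boundary_correction (p q : R) t : R :=
  p * r * ((E (t - g0) - E (- (t - g0))) / (E (g1 - g0) + E (- (g1 - g0)))) +
  q * ((E (t - g1) + E (- (t - g1))) / (E (g0 - g1) + E (- (g0 - g1)))).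

Definition boundary_correction' (p q : R) t : R :=
  p * ((E (t - g0) + E (- (t - g0))) / (E (g1 - g0) + E (- (g1 - g0)))) +
  q / r * ((E (t - g1) - E (- (t - g1))) / (E (g0 - g1) + E (- (g0 - g1)))).

Lemma is_derive_E c t : is_derive t 1 (fun t => E (t - c)) (E (t - c) / r).
Proof.
have dlin : is_derive t 1 (fun t => (t - c) / r) r^-1.
  have : is_derive t 1 (r^-1 \*: (id - cst c)) (r^-1 *: (1 - 0 : R)).
    by apply: is_deriveZ; apply: is_deriveB.
  rewrite subr0 /GRing.scale/= mulr1.
  by congr is_derive; apply/funext => x /=; rewrite !fctE /GRing.scale/= mulrC.
exact: (@is_derive1_comp _ expR (fun t => (t - c) / r) t _ _ (is_derive_expR _) dlin).
Qed.

Lemma is_derive_EN c t :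
  is_derive t 1 (fun t => E (- (t - c))) (- (E (- (t - c)) / r)).
Proof.
have dlin : is_derive t 1 (fun t => - (t - c) / r) (- r^-1).
  have : is_derive t 1 (- r^-1 \*: (id - cst c)) (- r^-1 *: (1 - 0 : R)).
    by apply: is_deriveZ; apply: is_deriveB.
  rewrite subr0 /GRing.scale/= mulr1.
  congr is_derive; apply/funext => x /=; rewrite !fctE /GRing.scale/=; ring.
rewrite -mulrN.
exact: (@is_derive1_comp _ expR (fun t => - (t - c) / r) t _ _ (is_derive_expR _) dlin).
Qed.

(** The correction and its derivative are both of this form, with the signs
   [p'] and [q'] exchanged. *)
Lemma is_derive_EE (p q p' q' : R) t : is_derive t 1
  (fun t => p * ((E (t - g0) + p' * E (- (t - g0))) / (E (g1 - g0) + E (- (g1 - g0)))) +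
   q * ((E (t - g1) + q' * E (- (t - g1))) / (E (g0 - g1) + E (- (g0 - g1)))))
  (p / r * ((E (t - g0) - p' * E (- (t - g0))) / (E (g1 - g0) + E (- (g1 - g0)))) +
   q / r * ((E (t - g1) - q' * E (- (t - g1))) / (E (g0 - g1) + E (- (g0 - g1))))).
Proof.
set D1 := (X in _ * (_ / X) + _); set D2 := (X in _ + _ * (_ / X)).
have := is_deriveD
  (is_deriveD (is_deriveZ (p / D1) (is_derive_E g0 t))
     (is_deriveZ (p * p' / D1) (is_derive_EN g0 t)))
  (is_deriveD (is_deriveZ (q / D2) (is_derive_E g1 t))
     (is_deriveZ (q * q' / D2) (is_derive_EN g1 t))).
rewrite /GRing.scale/=; congr is_derive; last by ring.
apply/funext => x.
transitivity (p / D1 * E (x - g0) + p * p' / D1 * E (- (x - g0)) +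
  (q / D2 * E (x - g1) + q * q' / D2 * E (- (x - g1)))) => //.
by rewrite /D1 /D2 /=; ring.
Qed.

Lemma boundary_correction_C1 p q :
  C1_pair (boundary_correction p q) (boundary_correction' p q) /\
  C1_pair (boundary_correction' p q) (alpha^-1 \*o boundary_correction p q).
Proof.
have rr : r * r = alpha by rewrite -expr2 sqr_sqrtr ?ltW.
have rn0 : r != 0 by rewrite gt_eqF.
have dB t : is_derive t 1 (boundary_correction p q) (boundary_correction' p q t).
  have := is_derive_EE (p * r) q (-1) 1 t.
  rewrite mulfK//; congr is_derive.
    by apply/funext => x; rewrite /boundary_correction !mulN1r !mul1r.
  by rewrite /boundary_correction' !mulN1r !mul1r opprK.
have dB' t : is_derive t 1 (boundary_correction' p q)
    ((alpha^-1 \*o boundary_correction p q) t).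
  have := is_derive_EE p (q / r) 1 (-1) t; congr is_derive.
    by apply/funext => x; rewrite /boundary_correction' !mulN1r !mul1r.
  rewrite /= /boundary_correction !mulN1r !mul1r opprK.
  have -> : alpha^-1 = (r * r)^-1 by rewrite rr.
  have pos (x y : R) : expR x + expR y != 0 by rewrite gt_eqF// addr_gt0 ?expR_gt0.
  by rewrite /=; field; rewrite !pos rn0.
have cont (u v : R -> R) : (forall t, is_derive t 1 u (v t)) -> continuous u.
  move=> du t; apply/differentiable_continuous/derivable1_diffP.
  by case: (du t).
split; split => //; first exact: cont dB'.
by move=> t; apply: cvgM; [exact: cvg_cst|exact: (cont _ _ dB)].
Qed.

Lemma boundary_correction_ends p q :
  boundary_correction p q g0 = q /\ boundary_correction' p q g1 = p.
Proof.
have pos (x y : R) : expR x + expR y != 0 by rewrite gt_eqF// addr_gt0 ?expR_gt0.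
rewrite /boundary_correction /boundary_correction' !subrr oppr0 !subrr.
by rewrite !mul0r !mulr0 !divff// !mulr1 add0r addr0.
Qed.

End boundary_correction.

End regularization.

Section higher_order.
Context {R : realType} (g0 g1 : R) (g01 : g0 < g1) (alpha : R) (alpha0 : 0 < alpha).
Local Notation L2 := (L2 g0 g1).
Local Notation dot := (L2_dot g0 g1).
Local Notation nrm := (L2_norm g0 g1).
Local Notation primitive_of := (primitive_of g0 g1).
Local Notation norm3 := (norm3 g0 g1).
Local Notation L := (Lop g0 g1 alpha).
Local Notation bc := (boundary_correction g0 g1 alpha).
Local Notation bc' := (boundary_correction' g0 g1 alpha).
Implicit Types (x : R -> R).

Let g1I : g1 \in `[g0, g1]. Proof. by rewrite in_itv/= lexx ltW. Qed.

Lemma LopE x x1 x2 : primitive_of x x1 -> primitive_of x1 x2 ->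
  L x = bc (x1 g1) (x g0).
Proof.
move=> px px1; have cx1 := primitive_continuous g01 px1.
by rewrite -(wderiv_continuous g01 px cx1 g1I).
Qed.

Lemma boundary_correction_primitive (p q : R) :
  primitive_of (bc p q) (bc' p q) /\
  primitive_of (bc' p q) (alpha^-1 \*o bc p q).
Proof.
have [A B] := boundary_correction_C1 g0 g1 alpha0 p q.
by split; exact: C1_primitive.
Qed.

Lemma complement_primitive x x1 x2 : primitive_of x x1 -> primitive_of x1 x2 ->
  primitive_of (x \- L x) (x1 \- bc' (x1 g1) (x g0)) /\
  primitive_of (x1 \- bc' (x1 g1) (x g0)) (x2 \- (alpha^-1 \*o L x)).
Proof.
move=> px px1; rewrite (LopE px px1).
have [A B] := boundary_correction_primitive (x1 g1) (x g0).
by split; exact: primitiveB.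
Qed.

(** [L x] is a combination of two fixed functions with coefficients [x' g1] and
   [x g0], which the H^2 norm of [x] controls. *)
Lemma Lop_bounded : exists2 M : R, 0 <= M & forall x x1 x2,
  primitive_of x x1 -> primitive_of x1 x2 ->
  sobolev_norm g0 g1 2 (x \- L x) <= M * sobolev_norm g0 g1 2 x.
Proof.
pose P := norm3 (bc 1 0) (bc' 1 0) (alpha^-1 \*o bc 1 0).
pose Q := norm3 (bc 0 1) (bc' 0 1) (alpha^-1 \*o bc 0 1).
pose K0 := (nrm (cst 1) + nrm (fun t => t - g1)) / (g1 - g0).
pose K1 := (nrm (cst 1) + nrm (fun t => t - g0)) / (g1 - g0).
have P0 : 0 <= P by exact: norm3_ge0.
have Q0 : 0 <= Q by exact: norm3_ge0.
have len : 0 < g1 - g0 by rewrite subr_gt0.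
have K0_ge0 : 0 <= K0 by rewrite /K0 divr_ge0 ?(ltW len)// addr_ge0 ?nrm_ge0.
have K1_ge0 : 0 <= K1 by rewrite /K1 divr_ge0 ?(ltW len)// addr_ge0 ?nrm_ge0.
exists (1 + (K1 * P + K0 * Q)).
  by rewrite addr_ge0// addr_ge0// mulr_ge0.
move=> x x1 x2 px px1.
have [pw pw1] := complement_primitive px px1.
rewrite (sobolev_norm2E g01 pw pw1) (sobolev_norm2E g01 px px1).
set N := norm3 x x1 x2.
have [Nx Nx1 Nx2] := nrm_le_norm3 g0 g1 x x1 x2.
have N0 : 0 <= N := norm3_ge0 _ _ _ _ _.
have Lx := primitive_L2 g01 px; have [Lx1 _] := px; have [Lx2 _] := px1.
have value (c : R) (u v : R) (y z : R) : `|c| * (g1 - g0) <= u * y + v * z ->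
    0 <= y -> 0 <= z -> u <= N -> v <= N -> `|c| <= (y + z) / (g1 - g0) * N.
  move=> H y0 z0 uN vN; rewrite mulrAC ler_pdivlMr//.
  rewrite (le_trans H)// mulrDl lerD// [leRHS]mulrC ler_wpM2r//.
have x_g0 : `|x g0| <= K0 * N.
  by apply: (value _ _ _ _ _ (proj1 (trace_bound g01 px))); rewrite ?nrm_ge0.
have x1_g1 : `|x1 g1| <= K1 * N.
  by apply: (value _ _ _ _ _ (proj2 (trace_bound g01 px1))); rewrite ?nrm_ge0.
have L2bc p q : [/\ L2 (bc p q), L2 (bc' p q) & L2 (alpha^-1 \*o bc p q)].
  have [A B] := boundary_correction_primitive p q.
  by split; [exact: primitive_L2 A|exact: (proj1 A)|exact: (proj1 B)].
rewrite (LopE px px1); set p := x1 g1; set q := x g0.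
have [Lpq Lpq' Lpq''] := L2bc p q.
rewrite (le_trans (norm3B _ _ _ _ _ _))// mulrDl mul1r lerD2l.
have bcE : bc p q = (p \*o bc 1 0) \+ (q \*o bc 0 1).
  by apply/funext => t; rewrite /boundary_correction /=; ring.
have bcE' : bc' p q = (p \*o bc' 1 0) \+ (q \*o bc' 0 1).
  by apply/funext => t; rewrite /boundary_correction' /=; ring.
have bcE'' : alpha^-1 \*o bc p q =
    (p \*o (alpha^-1 \*o bc 1 0)) \+ (q \*o (alpha^-1 \*o bc 0 1)).
  by rewrite bcE; apply/funext => t /=; ring.
rewrite bcE'' bcE bcE'.
have [A1 A2 A3] := L2bc 1 0; have [B1 B2 B3] := L2bc 0 1.
rewrite (le_trans (norm3D _ _ _ _ _ _)) ?norm3Z//; try exact: L2Z.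
rewrite -/P -/Q mulrDl lerD//.
  by rewrite mulrAC ler_wpM2r.
by rewrite mulrAC ler_wpM2r.
Qed.

(** By [Lop_bounded] the supremum that defines [C_L] is that of a bounded set, so
   that it is an upper bound. Normalizing [x] needs a nonzero norm; when the norm
   is zero, the crude bound already gives the claim. *)
Lemma C_L_bound x x1 x2 : primitive_of x x1 -> primitive_of x1 x2 ->
  sobolev_norm g0 g1 2 (x \- L x) <= C_L g0 g1 alpha * sobolev_norm g0 g1 2 x.
Proof.
move=> px px1; have [M M0 LM] := Lop_bounded.
set N := sobolev_norm g0 g1 2 x.
have [N_eq0|Nn0] := eqVneq N 0.
  by rewrite (le_trans (LM _ _ _ px px1))// -/N N_eq0 !mulr0.
have N0 : 0 < N by rewrite lt_def Nn0 /N (sobolev_norm2E g01 px px1) norm3_ge0.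
have Ni0 : 0 < N^-1 by rewrite invr_gt0.
have py := primitiveZ N^-1 px; have py1 := primitiveZ N^-1 px1.
have [pw pw1] := complement_primitive px px1.
have Lx := primitive_L2 g01 px; have [Lx1 _] := px; have [Lx2 _] := px1.
have Lw := primitive_L2 g01 pw; have [Lw1 _] := pw; have [Lw2 _] := pw1.
have Ny : sobolev_norm g0 g1 2 (N^-1 \*o x) = 1.
  rewrite (sobolev_norm2E g01 py py1) norm3Z// -(sobolev_norm2E g01 px px1).
  by rewrite gtr0_norm// mulVf.
have yE : (N^-1 \*o x) \- L (N^-1 \*o x) = N^-1 \*o (x \- L x).
  rewrite (LopE px px1) (LopE py py1); apply/funext => t.
  by rewrite /boundary_correction /=; ring.
have NyL : sobolev_norm g0 g1 2 ((N^-1 \*o x) \- L (N^-1 \*o x)) =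
    N^-1 * sobolev_norm g0 g1 2 (x \- L x).
  rewrite yE (sobolev_norm2E g01 (primitiveZ _ pw) (primitiveZ _ pw1)) norm3Z//.
  by rewrite gtr0_norm// (sobolev_norm2E g01 pw pw1).
rewrite -ler_pdivrMr// mulrC -NyL; apply: ub_le_sup; last first.
  exists (N^-1 \*o x) => //; split; last by rewrite Ny.
  apply: (primitive_sobolev g01 py).
  exact: (@primitive_sobolev _ _ _ g01 0 _ _ py1 (L2Z _ Lx2)).
exists M => _ [y [sy y1] <-].
have [qy /(sobolevS g01)[qy1 _]] := sobolevS g01 sy.
by rewrite (le_trans (LM _ _ _ qy qy1))// ler_piMr.
Qed.

(** [y = b2] solves [y - alpha y'' = x] for [x = a']. Its part [x - L x] is bounded
   by the constant [C_L]; the remainder [q] satisfies the boundary conditions and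
   [q - alpha q'' = alpha x''], so that [energy_estimate] applies. *)
Lemma error_H1_order zeta a x x1 x2 b b1 : alpha < 1 ->
  primitive_of zeta a -> primitive_of a x -> primitive_of x x1 ->
  primitive_of x1 x2 -> primitive_of b b1 ->
  primitive_of b1 (alpha^-1 \*o (b \- zeta)) -> b g0 = zeta g0 -> b1 g1 = a g1 ->
  sobolev_norm g0 g1 1 (a \- b1)
  <= (1 + C_L g0 g1 alpha) * alpha * sobolev_norm g0 g1 2 x.
Proof.
move=> alpha1 pzeta pa px px1 pb pb1 b0 b11.
set y := alpha^-1 \*o (b \- zeta) in pb1 *.
have pe : primitive_of (a \- b1) (x \- y) := error_primitive pa pb1.
have py : primitive_of y (- alpha^-1 \*o (a \- b1)) :=
  error_primitive_b2 alpha pzeta pb.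
have py1 := primitiveZ (- alpha^-1) pe.
have [pw pw1] := complement_primitive px px1.
have pq := primitiveB py pw; have pq1 := primitiveB py1 pw1.
have Le := primitive_L2 g01 pe; have [Ld _] := pe.
have Lw := primitive_L2 g01 pw; have [Lw1 _] := pw; have [Lw2 _] := pw1.
have Lq := primitive_L2 g01 pq; have [Lq1 _] := pq; have [Lq2 _] := pq1.
have Lx2 := proj1 px1.
have [bc0 bc1] := boundary_correction_ends g0 g1 alpha (x1 g1) (x g0).
have al01 : 0 < alpha <= 1 by rewrite alpha0 ltW.
have := energy_estimate g01 al01 pq pq1.
set q := y \- _; set q1 := _ \- _; set q2 := _ \- _.
move=> energy; have {energy} : alpha * norm3 q q1 q2 <= nrm (q \- (alpha \*o q2)).
  apply: energy.
    by rewrite /q /= (LopE px px1) bc0 /y /= b0 !subrr mulr0 subr0.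
  by rewrite /q1 /= bc1 b11 !subrr mulr0 subr0.
have -> : q \- (alpha \*o q2) = alpha \*o x2.
  by apply/funext => t; rewrite /q /q2 /=; field; rewrite gt_eqF.
rewrite nrmZ// gtr0_norm// ler_pM2l// => qx2.
have [_ _ x2N] := nrm_le_norm3 g0 g1 x x1 x2.
have yN : norm3 y (- alpha^-1 \*o (a \- b1)) (- alpha^-1 \*o (x \- y)) <=
    (1 + C_L g0 g1 alpha) * norm3 x x1 x2.
  have -> : norm3 y (- alpha^-1 \*o (a \- b1)) (- alpha^-1 \*o (x \- y)) =
      norm3 (q \+ (x \- L x)) (q1 \+ (x1 \- bc' (x1 g1) (x g0)))
        (q2 \+ (x2 \- (alpha^-1 \*o L x))).
    by congr norm3; apply/funext => t; rewrite /q /q1 /q2 /=; ring.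
  rewrite (le_trans (norm3D _ _ _ _ _ _))// mulrDl mul1r lerD//.
    exact: le_trans qx2 x2N.
  rewrite -(sobolev_norm2E g01 pw pw1) -(sobolev_norm2E g01 px px1).
  exact: C_L_bound px px1.
rewrite (sobolev_norm1E g01 pe) (sobolev_norm2E g01 px px1).
rewrite mulrAC [leRHS]mulrC -(ler_pdivrMl _ _ alpha0) (le_trans _ yN)//.
rewrite -(@ler_pXn2r _ 2)// ?nnegrE ?mulr_ge0 ?norm3_ge0 ?sqrtr_ge0 ?invr_ge0//;
  last exact: ltW.
rewrite exprMn sqr_norm3 sqr_sqrtr ?addr_ge0 ?dot_ge0//.
have := dot_ge0 g0 g1 y; move: (dot y y) => Y Y0.
rewrite !dotZl ?dotZr//; try exact: L2Z.
by rewrite !mulrA !mulrNN -!expr2; lra.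
Qed.

End higher_order.

(** This is the right-hand side of [error_H1]; the test function is chosen before
   [alpha], and each of the three terms then gets at most a third of [eps ^+ 2]. *)
Lemma error_bound_eventually_small (R : realType) (g0 g1 : R)
    (f phi : R -> R) (eps : R) :
  0 < eps -> L2_norm g0 g1 (f \- phi) <= eps ^+ 2 / (3 * (L2_norm g0 g1 f + 1)) ->
  \forall alpha \near 0^'+,
    alpha * L2_norm g0 g1 f ^+ 2 +
    (Num.sqrt alpha * L2_norm g0 g1 f * L2_norm g0 g1 (derive1 phi) +
     L2_norm g0 g1 f * L2_norm g0 g1 (f \- phi)) <= eps ^+ 2.
Proof.
move=> eps0; set F := L2_norm _ _ f; set G := L2_norm _ _ (derive1 _).
set H := L2_norm _ _ (f \- phi) => Hle.
have F0 : 0 <= F by exact: nrm_ge0.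
have G0 : 0 <= G by exact: nrm_ge0.
have H0 : 0 <= H by exact: nrm_ge0.
have pos y : 0 <= y -> 0 < eps ^+ 2 / (3 * (y + 1)).
  by move=> y0; rewrite divr_gt0 ?exprn_gt0// mulr_gt0// ltr_wpDl.
have third y z : 0 <= y -> z <= eps ^+ 2 / (3 * (y + 1)) -> z * y <= eps ^+ 2 / 3.
  move=> y0 zy; rewrite (le_trans (ler_wpM2r y0 zy))//.
  have y1 : 0 < y + 1 by rewrite ltr_wpDl.
  have -> : eps ^+ 2 / (3 * (y + 1)) * y = eps ^+ 2 / 3 * (y / (y + 1)).
    by field; rewrite gt_eqF.
  by rewrite ler_piMr ?divr_ge0 ?sqr_ge0// ler_pdivrMr// mul1r lerDl.
near=> alpha.
have al0 : 0 < alpha by near: alpha; exact: nbhs_right_gt.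
have A : alpha * F ^+ 2 <= eps ^+ 2 / 3.
  apply: third; rewrite ?sqr_ge0//; near: alpha; apply: nbhs_right_le.
  exact/pos/sqr_ge0.
have B : Num.sqrt alpha * F * G <= eps ^+ 2 / 3.
  rewrite -mulrA; apply: third; first by rewrite mulr_ge0.
  have c0 : 0 < eps ^+ 2 / (3 * (F * G + 1)).
    exact/pos/mulr_ge0.
  rewrite -[leRHS](ger0_norm (ltW c0)) -sqrtr_sqr ler_wsqrtr//.
  by near: alpha; apply: nbhs_right_le; exact/exprn_gt0/pos/mulr_ge0.
have C : F * H <= eps ^+ 2 / 3 by rewrite mulrC; exact: third.
by lra.
Unshelve. all: by end_near. Qed.

Theorem theorem3p10 (R : realType)
    (Omega : set (R * R * R)) (sigma : {measure set (R * R * R) -> \bar R})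
    (p : R) (j v : R * R * R -> R)
    (gamma dgamma : R -> R * R * R) (g dg : R * R * R -> R)
    (Cgamma Cgamma' Cg Cg' g0 g1 : R)
    (a0 zeta0 : R -> R) (b : R -> R -> R)
    (hOmega : bounded_domain Omega) (hC11 : C11_boundary Omega)
    (hsigma : is_surface_measure Omega sigma) (hp : 3 < p)
    (hj : trace_space Omega sigma p j)
    (hj0 : \int[sigma]_(x in boundary Omega) j x = 0)
    (hv : neumann_solution Omega sigma j v)
    (hgamma : C1_curve gamma dgamma)
    (hGamma : gamma @` `[0, 1]%classic `<=` boundary Omega)
    (hg : C1_along gamma dgamma g dg)
    (hCgamma : 0 < Cgamma) (hCgamma' : 0 < Cgamma') (hCg : 0 < Cg) (hCg' : 0 < Cg')
    (hdgamma : forall s : R, s \in `[0, 1] -> Cgamma <= enorm3 (dgamma s) <= Cgamma')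
    (hdg : forall s : R, s \in `[0, 1] -> Cg <= `|dg (gamma s)| <= Cg')
    (hI : g @` (gamma @` `[0, 1]%classic) = `[g0, g1]%classic) (hg01 : g0 < g1)
    (ha0 : solves_P g0 g1 v gamma g a0) (ha0g1 : a0 g1 = 0)
    (hzeta0 : L2 g0 g1 zeta0)
    (hzeta0v : forall s : R, s \in `[0, 1] -> zeta0 (g (gamma s)) = v (gamma s))
    (hb : forall alpha, 0 < alpha < 1 -> W2 g0 g1 (b alpha))
    (hbeq : forall alpha, 0 < alpha < 1 -> normal_equation g0 g1 alpha zeta0 (b alpha)) :
  let a alpha := wderiv g0 g1 (b alpha) in
  [/\ (fun alpha => sobolev_norm g0 g1 1 (a0 \- a alpha)) @ 0^'+ --> 0,
      forall alpha, 0 < alpha < 1 ->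
        L2_norm g0 g1 (a0 \- a alpha)
        <= Num.sqrt alpha * L2_norm g0 g1 (wderiv g0 g1 a0) &
      sobolev g0 g1 3 a0 ->
      forall alpha, 0 < alpha < 1 ->
        sobolev_norm g0 g1 1 (a0 \- a alpha)
        <= (1 + C_L g0 g1 alpha) * alpha * sobolev_norm g0 g1 2 (wderiv g0 g1 a0)].
Proof.
move=> a; have [sa0 a0_int] := ha0.
have [pa _] := sobolevS hg01 sa0.
have La0 := primitive_L2 hg01 pa.
have zeta0E t : t \in `[g0, g1] ->
    zeta0 t = \int[lebesgue_measure]_(x in `[g0, t]) a0 x.
  move=> tI; have : (`[g0, g1]%classic : set R) t by [].
  by rewrite -hI => -[_ [s sI <-] <-]; rewrite hzeta0v// a0_int.
have zeta00 : zeta0 g0 = 0.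
  by rewrite zeta0E ?Rintegral_point// in_itv/= lexx ltW.
have pzeta : primitive_of g0 g1 zeta0 a0.
  by split => // t tI; rewrite zeta00 add0r zeta0E.
set f := wderiv g0 g1 a0 in pa *.
have sol alpha : 0 < alpha < 1 -> [/\ primitive_of g0 g1 (b alpha) (a alpha),
    primitive_of g0 g1 (a alpha) (alpha^-1 \*o (b alpha \- zeta0)),
    b alpha g0 = zeta0 g0 & a alpha g1 = a0 g1].
  move=> al01; have /andP[al0 _] := al01.
  have [sb b0 b1] := hb _ al01.
  have [pb /(sobolevS hg01)[pb1 _]] := sobolevS hg01 sb.
  split; rewrite ?zeta00 ?ha0g1//.
  apply: (regularized_solution hg01 al0 hzeta0 (primitive_L2 hg01 pb) pb1).
  exact: (normal_equation_solution hg01 al0 hzeta0 (hb _ al01) (hbeq _ al01)).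
split.
- apply/cvgrPdist_le => eps eps0.
  pose e' := eps ^+ 2 / (3 * (L2_norm g0 g1 f + 1)).
  have e'0 : 0 < e'.
    by rewrite divr_gt0 ?exprn_gt0// mulr_gt0// ltr_wpDl// nrm_ge0.
  have [phi tphi fphi] := test_function_dense hg01 (proj1 pa) e'0.
  near=> alpha; have al01 : 0 < alpha < 1.
    by apply/andP; split; near: alpha; [exact: nbhs_right_gt|exact: nbhs_right_lt].
  have /andP[al0 _] := al01; have [pb pb1 b0 b1] := sol _ al01.
  rewrite sub0r normrN ger0_norm ?sqrtr_ge0//.
  rewrite (sobolev_norm1E hg01 (error_primitive pa pb1)).
  rewrite -[leRHS](ger0_norm (ltW eps0)) -sqrtr_sqr ler_wsqrtr//.
  rewrite (le_trans (error_H1 hg01 al0 pzeta pa pb pb1 b0 b1 tphi (lexx _)))//.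
  by near: alpha; exact: error_bound_eventually_small.
- move=> alpha al01; have /andP[al0 _] := al01; have [pb pb1 b0 b1] := sol _ al01.
  exact: (error_L2 hg01 al0 pzeta pa pb pb1 b0 b1).
- move=> sa3 alpha al01; have /andP[al0 al1] := al01.
  have [pb pb1 b0 b1] := sol _ al01.
  have [_ /(sobolevS hg01)[px /(sobolevS hg01)[px1 _]]] := sobolevS hg01 sa3.
  exact: (error_H1_order hg01 al0 al1 pzeta pa px px1 pb pb1 b0 b1).
Unshelve. all: by end_near. Qed.
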